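(* Let $n\ge1$, let $H$ be a complex Hilbert space and let $T=(T_1,\ldots,T_n)\in L(H)^n$ be a commuting tuple that is regular at $z=0$. Then the row operator $T:H^n\to H$ is a partial isometry if and only if $T=T_0\oplus T_1\in L(H_0\oplus H_1)^n$ is the (orthogonal) direct sum of a spherical coisometry $T_0\in L(H_0)^n$ and a commuting tuple $T_1\in L(H_1)^n$ which is unitarily equivalent to $M_z\in L(H_1(\mathbb B,\mathcal D))^n$ for some Hilbert space $\mathcal D$.
   Context: $L(H)$ is the algebra of bounded linear operators on $H$. All Hilbert spaces are complex; the Hilbert spaces $H_0,H_1,\mathcal D$ are allowed to be $\{0\}$. (The Hilbert space $H_1$ is not to be confused with the function space $H_1(\mathbb B,\mathcal D)$.) For a commuting tuple $T\in L(H)^n$, the same letter $T$ denotes the row operator $T:H^n\to H$, $(h_i)_{i=1}^n\mapsto\sum_{i=1}^n T_ih_i$. If $TH^n=\sum_iT_iH$ is closed, put $W(T)=H\ominus\sum_{i=1}^nT_iH$. For $z\in\mathbb C^n$, $Z:H^n\to H$ is the row operator $(h_i)\mapsto\sum_i z_ih_i$, and $\|z\|$ is the Euclidean norm. $T$ is regular at $z=0$ if $TH^n\subset H$ is closed and there is $\epsilon>0$ such that for all $z\in\mathbb C^n$ with $\|z\|<\epsilon$ the subspace $(T-Z)H^n\subset H$ is closed and $H$ is the algebraic direct sum $H=(T-Z)H^n\oplus W(T)$. A spherical coisometry is a commuting tuple $S\in L(H_0)^n$ with $\sum_{i=1}^nS_iS_i^*=1_{H_0}$. $\mathbb B\subset\mathbb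 C^n$ is the open Euclidean unit ball. $H_1(\mathbb B,\mathcal D)$ is the $\mathcal D$-valued Drury-Arveson space, i.e. the analytic functional Hilbert space on $\mathbb B$ with reproducing kernel $(z,w)\mapsto(1-\langle z,w\rangle)^{-1}1_{\mathcal D}$; equivalently the space of all analytic $f=\sum_{\alpha\in\mathbb N^n}f_\alpha z^\alpha:\mathbb B\to\mathcal D$ with $\|f\|^2=\sum_\alpha\frac{\alpha!}{|\alpha|!}\|f_\alpha\|^2<\infty$. $M_z=(M_{z_1},\ldots,M_{z_n})$ is the tuple of multiplications by the coordinate functions. Two tuples are unitarily equivalent if a single unitary operator intertwines them componentwise. *)

(* Defs.v *)
From HB Require Import structures.
From mathcomp Require Import all_boot all_order all_algebra.
From mathcomp Require Import complex.
From mathcomp Require Import all_classical all_reals all_analysis.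

Set Implicit Arguments.
Unset Strict Implicit.
Unset Printing Implicit Defensive.

Import Order.TTheory GRing.Theory Num.Theory.
Import numFieldNormedType.Exports.

Local Open Scope classical_set_scope.
Local Open Scope ring_scope.

(* The complex field is [R[i]] for an arbitrary [R : realType]; norms take
   their values in [R[i]], as nonnegative real elements.  Inner products are
   linear in the first and conjugate-linear in the second argument.          *)
HB.mixin Record isHilbert (R : realType) (H : Type)
    of CompleteNormedModule R[i] H := {
  inner : {dot H for (@Num.conj R[i])};
  norm_inner : forall x : H, `|x| ^+ 2 = inner x x
}.

#[short(type="hilbertType")]
HB.structure Definition Hilbert (R : realType) :=
  {H of CompleteNormedModule R[i] H & isHilbert R H}.

Record boundedOp (R : realType) (H K : hilbertType R) := BoundedOp {
  bop_fun :> {linear H -> K};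
  bop_continuous : continuous bop_fun
}.

Section Operators.
Variables (R : realType).
Implicit Types H K : hilbertType R.

Definition adjoint_of H K (A : boundedOp H K) (B : boundedOp K H) : Prop :=
  forall x y, inner (A x) y = inner x (B y).

Definition orthocomplement H (A : set H) : set H :=
  [set x | forall a, A a -> inner x a = 0].

(* [A] and [B] are meant to be linear subspaces, not necessarily closed. *)
Definition algebraic_direct_sum H (A B : set H) : Prop :=
  (forall x, exists a b, [/\ A a, B b & x = a + b]) /\ A `&` B `<=` [set 0].

(* Isometric on the orthogonal complement of the kernel; the inner product of
   the domain is passed explicitly so that the domain may be a power of [H]. *)
Definition partial_isometry (V : lmodType R[i]) (ip : V -> V -> R[i])
    H (f : V -> H) : Prop :=
  forall x, (forall y, f y = 0 -> ip x y = 0) -> inner (f x) (f x) = ip x x.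

Definition unitary H K (U : {linear H -> K}) : Prop :=
  (forall x y, inner (U x) (U y) = inner x y) /\ (forall y, exists x, U x = y).

End Operators.

(* Complex Frechet differentiability; the abbreviation only helps the inference
   of the normed structure on ['rV_n].                                       *)
Definition cdifferentiable (R : realType) (V W : normedModType R[i])
    (f : V -> W) (z : V) : Prop := differentiable f z.

Section Tuples.
Variables (R : realType) (n : nat).
Implicit Types H K D F : hilbertType R.

Definition optuple H := 'I_n -> boundedOp H H.

Definition commuting H (T : optuple H) : Prop :=
  forall i j x, T i (T j x) = T j (T i x).

Definition power_inner H (h g : 'I_n -> H) : R[i] := \sum_(i < n) inner (h i) (g i).

Definition row_op H (T : optuple H) (h : 'I_n -> H) : H :=
  \sum_(i < n) T i (h i).

Definition row_scalar H (z : 'rV[R[i]]_n) (h : 'I_n -> H) : H :=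
  \sum_(i < n) z 0 i *: h i.

Definition cdot (z w : 'rV[R[i]]_n) : R[i] := \sum_(i < n) z 0 i * (w 0 i)^*.

(* The norm of the library on ['rV_n] is the maximum norm. *)
Definition enorm (z : 'rV[R[i]]_n) : R[i] := sqrtC (cdot z z).

Definition unit_ball : set 'rV[R[i]]_n := [set z | enorm z < 1].

Definition wandering H (T : optuple H) : set H :=
  orthocomplement (range (row_op T)).

(* [0 < eps] in [R[i]] forces [eps] to be real. *)
Definition regular_at0 H (T : optuple H) : Prop :=
  closed (range (row_op T)) /\
  exists2 eps : R[i], 0 < eps & forall z : 'rV[R[i]]_n, enorm z < eps ->
    let TZ := range (fun h : 'I_n -> H => row_op T h - row_scalar z h) in
    closed TZ /\ algebraic_direct_sum TZ (wandering T).

Definition spherical_coisometry H (S : optuple H) : Prop :=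
  commuting S /\
  exists2 S' : optuple H, (forall i, adjoint_of (S i) (S' i)) &
    forall x, \sum_(i < n) S i (S' i x) = x.

Definition unitarily_equivalent H K (S : optuple H) (T : optuple K) : Prop :=
  exists2 U : {linear H -> K}, unitary U & forall i x, U (S i x) = T i (U x).

(* [J] identifies [H] with the Hilbert space direct sum of [H0] and [H1]; the
   product norm of the library on [H0 * H1] is not the Hilbert one and is not
   used.                                                                     *)
Definition is_direct_sum H H0 H1
    (T : optuple H) (T0 : optuple H0) (T1 : optuple H1) : Prop :=
  exists J : {linear (H0 * H1)%type -> H},
    [/\ forall p q, inner (J p) (J q) = inner p.1 q.1 + inner p.2 q.2,
        forall x, exists p, J p = x
      & forall i p, T i (J p) = J (T0 i p.1, T1 i p.2)].

(* [F], viewed through the evaluation map [ev], is a Hilbert space of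
   [D]-valued functions on [A] with reproducing kernel [k], where [k z w] is an
   operator on [D]: every [k(., w) x] belongs to [F] and
   [<f, k(., w) x> = <f(w), x>].  Functions are total on [X], but only their
   values on [A] matter.                                                     *)
Record is_rkhs (X : Type) (A : set X) D F (ev : F -> X -> D)
    (k : X -> X -> D -> D) : Prop := {
  rkhs_linear : forall (a : R[i]) (f g : F) z, A z ->
    ev (a *: f + g) z = a *: ev f z + ev g z;
  rkhs_injective : forall f g : F, (forall z, A z -> ev f z = ev g z) -> f = g;
  rkhs_reproducing : forall w x, A w -> exists2 kwx : F,
    (forall z, A z -> ev kwx z = k z w x) &
    (forall f : F, inner f kwx = inner (ev f w) x)
}.

(* This determines [(F, ev)] up to a unitary operator that is compatible with
   the evaluation maps.                                                      *)
Definition is_drury_arveson D F (ev : F -> 'rV[R[i]]_n -> D)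
    : Prop :=
  is_rkhs unit_ball ev (fun z w x => (1 - cdot z w)^-1 *: x) /\
  (forall (f : F) z, unit_ball z -> cdifferentiable (ev f) z).

Definition is_mult_tuple D F (ev : F -> 'rV[R[i]]_n -> D) (M : optuple F)
    : Prop :=
  forall i (f : F) z, unit_ball z -> ev (M i f) z = z 0 i *: ev f z.

End Tuples.

(* Main.v *)
Require Import Defs.
From HB Require Import structures.
From mathcomp Require Import all_boot all_order all_algebra.
From mathcomp Require Import complex.
From mathcomp Require Import all_classical all_reals all_analysis.
From mathcomp Require Import ring lra.

Set Implicit Arguments.
Unset Strict Implicit.
Unset Printing Implicit Defensive.

Import Order.TTheory GRing.Theory Num.Theory.
Import numFieldNormedType.Exports.

Local Open Scope classical_set_scope.
Local Open Scope ring_scope.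

(* For a partial isometry T with adjoint tuple T', Q = sum_i T_i T'_i is an
   orthogonal projection with Q T = T, and P = 1 - Q projects onto W(T).  With
   A_z = sum_i z_i T'_i, which has norm at most |z|, one has
   1 - A_z = (T - Z) T' + P, so that P (1 - A_z)^-1 h is the W(T)-component of
   h along (T - Z)H^n.  Regularity says that this component is unique for small
   z; hence g |-> P (1 - A_z)^-1 g turns T_i into multiplication by z_i for
   small z and, by comparing the coefficients of the Neumann series, on the
   whole ball.  The functions of z so obtained are the vectors of a
   Drury-Arveson space with kernel vectors (1 - A_w)^-* x, x in W(T).  Its null
   space H_0 reduces T, T is a spherical coisometry on H_0, and H_0^\perp
   itself, with these functions as evaluation map, is the Drury-Arveson space.

   Conversely, <M_z M_z^* f, k_w x> = <f, k_w x - k_0 x> gives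
   M_z M_z^* f = f - f(0), hence M_z M_z^* M_z = M_z. *)

(** * Hilbert spaces *)

Section InnerTheory.
Variables (R : realType) (H : hilbertType R).
Implicit Types (x y z : H) (a : R[i]).

Lemma innerC x y : inner x y = (inner y x)^*.
Proof. by rewrite hermC expr0 mul1r. Qed.

Lemma innerDl x y z : inner (x + y) z = inner x z + inner y z.
Proof. exact: linearDl. Qed.

Lemma innerDr x y z : inner x (y + z) = inner x y + inner x z.
Proof. exact: linearDr. Qed.

Lemma innerZl a x y : inner (a *: x) y = a * inner x y.
Proof. exact: linearZl_LR. Qed.

Lemma innerZr a x y : inner x (a *: y) = a^* * inner x y.
Proof. by rewrite linearZr_LR. Qed.

Lemma innerNl x y : inner (- x) y = - inner x y.
Proof. exact: linearNl. Qed.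

Lemma innerNr x y : inner x (- y) = - inner x y.
Proof. exact: linearNr. Qed.

Lemma innerBl x y z : inner (x - y) z = inner x z - inner y z.
Proof. by rewrite innerDl innerNl. Qed.

Lemma innerBr x y z : inner x (y - z) = inner x y - inner x z.
Proof. by rewrite innerDr innerNr. Qed.

Lemma inner0l x : inner 0 x = 0.
Proof. exact: linear0l. Qed.

Lemma inner0r x : inner x 0 = 0.
Proof. exact: linear0r. Qed.

Lemma inner_suml I (r : seq I) (F : I -> H) y :
  inner (\sum_(i <- r) F i) y = \sum_(i <- r) inner (F i) y.
Proof. by elim/big_rec2: _ => [|i u v _ <-]; rewrite ?inner0l ?innerDl. Qed.

Lemma inner_sumr I (r : seq I) (F : I -> H) y :
  inner y (\sum_(i <- r) F i) = \sum_(i <- r) inner y (F i).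
Proof. by elim/big_rec2: _ => [|i u v _ <-]; rewrite ?inner0r ?innerDr. Qed.

Lemma inner_ge0 x : 0 <= inner x x.
Proof. by rewrite -norm_inner exprn_ge0. Qed.

Lemma inner_eq0 x : inner x x = 0 -> x = 0.
Proof. by rewrite -norm_inner => /eqP; rewrite expf_eq0 /= normr_eq0 => /eqP. Qed.

Lemma inner_eqP x y : (forall z, inner x z = inner y z) -> x = y.
Proof.
move=> xy; apply/eqP; rewrite -subr_eq0; apply/eqP/inner_eq0.
by rewrite innerBl xy subrr.
Qed.

Lemma cauchy_schwarz x y : `|inner x y| <= `|x| * `|y|.
Proof.
have [->|y0] := eqVneq y 0; first by rewrite inner0r !normr0 mulr0.
have ny : 0 < `|y| ^+ 2 by rewrite exprn_gt0// normr_gt0.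
rewrite -(@ler_pXn2r _ 2) ?nnegrE ?mulr_ge0// exprMn.
(* This vector is [|y|^2] times the component of [x] orthogonal to [y]; the factor avoids a
   division. *)
have := inner_ge0 (`|y| ^+ 2 *: x - inner x y *: y).
rewrite !(innerBl, innerBr, innerZl, innerZr) -!norm_inner (innerC y x).
rewrite conj_Creal ?ger0_real ?exprn_ge0// normCK.
set c := inner x y; set X := `|x|; set Y := `|y| => h.
have : 0 <= Y ^+ 2 * (X ^+ 2 * Y ^+ 2 - c * c^*) by move: h; congr (0 <= _); ring.
by rewrite pmulr_rge0// subr_ge0.
Qed.

Lemma parallelogram x y :
  `|x + y| ^+ 2 + `|x - y| ^+ 2 = 2 * (`|x| ^+ 2 + `|y| ^+ 2).
Proof.
rewrite !norm_inner !(innerDl, innerDr, innerNl, innerNr); ring.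
Qed.

End InnerTheory.

(** * Closed subspaces as Hilbert spaces *)

Record closedSubspace (R : realType) (H : hilbertType R) := ClosedSubspace {
  csub_set :> set H;
  csub0 : csub_set 0;
  csubP : forall (a : R[i]) x y, csub_set x -> csub_set y -> csub_set (a *: x + y);
  csub_closed : closed csub_set }.

Arguments csub_closed {R H} S : rename.

Section Subspace.
Variables (R : realType) (H : hilbertType R) (S : closedSubspace H).

Definition csub_pred : {pred H} := [pred x | x \in csub_set S].

Lemma csub_submod_closed : submod_closed csub_pred.
Proof.
split=> [|a x y]; rewrite !inE/= ?in_setE; first exact: csub0.
exact: csubP.
Qed.

HB.instance Definition _ := GRing.isSubmodClosed.Build R[i] H csub_pred
  csub_submod_closed.

Definition csub_type := {x : H | csub_pred x}.
HB.instance Definition _ := SubChoice.on csub_type.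
HB.instance Definition _ := [SubChoice_isSubLmodule of csub_type by <:].

Definition csub_norm (x : csub_type) : R[i] := `|val x|.

Fact csub_norm_triangle x y : csub_norm (x + y) <= csub_norm x + csub_norm y.
Proof. by rewrite /csub_norm raddfD ler_normD. Qed.

Fact csub_normZ (l : R[i]) x : csub_norm (l *: x) = `|l| * csub_norm x.
Proof. by rewrite /csub_norm linearZ normrZ. Qed.

Fact csub_norm_eq0 x : csub_norm x = 0 -> x = 0.
Proof. by move/eqP; rewrite normr_eq0 => /eqP h; apply: val_inj; rewrite h raddf0. Qed.

HB.instance Definition _ := Lmodule_isNormed.Build R[i] csub_type
  csub_norm_triangle csub_normZ csub_norm_eq0.

Lemma csub_normE (x : csub_type) : `|x| = `|val x|.
Proof. by []. Qed.

(** The image filter converges in [H], closedness of [S] keeps the limit in [S], and the two norms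
    agree. *)
Fact csub_complete (F : set_system csub_type) : ProperFilter F -> cauchy F -> cvg F.
Proof.
move=> FF /cauchyP Fc.
have : cauchy ((val : csub_type -> H) @ F).
  apply/cauchyP => e e0; have [x Fx] := Fc _ e0; exists (val x).
  change (F ((val : csub_type -> H) @^-1` ball (val x) e)).
  apply: filterS Fx => y.
  by rewrite -!ball_normE /ball_/= csub_normE raddfB.
move=> /cauchy_cvg/cvg_ex[l Fl].
have Sl : csub_set S l.
  apply: (@closed_cvg _ _ F _ (val : csub_type -> H) _ (csub_closed S) _ l Fl).
  by apply: nearW => x /=; have := valP x; rewrite /csub_pred/= !inE.
have Pl : csub_pred l by rewrite !inE.
apply/cvg_ex; exists (exist _ l Pl : csub_type).
apply/cvgrPdist_lt => e e0.
have /cvgrPdist_lt/(_ e e0) := Fl.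
change (F ((val : csub_type -> H) @^-1` [set y | `|l - y| < e]) ->
  F [set y : csub_type | `|(exist _ l Pl : csub_type) - y| < e]).
by apply: filterS => y; rewrite /= csub_normE raddfB.
Qed.

HB.instance Definition _ := Uniform_isComplete.Build csub_type csub_complete.

Definition csub_inner (x y : csub_type) : R[i] := inner (val x) (val y).

Fact csub_inner_bilinear : bilinear_for
   (GRing.Scale.Law.clone _ _ *%R _)
   (GRing.Scale.Law.clone _ _ (@Num.conj R[i] \; *%R) _) csub_inner.
Proof.
split=> [y|x] a u v; rewrite /csub_inner (linearP val).
  by rewrite innerDl innerZl.
by rewrite innerDr innerZr.
Qed.

HB.instance Definition _ := 
  bilinear_isBilinear.Build R[i] csub_type csub_type R[i] _ _
    csub_inner csub_inner_bilinear.

Fact csub_inner_herm x y : csub_inner x y = (-1) ^+ false * (csub_inner y x)^*.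
Proof. by rewrite expr0 mul1r /csub_inner innerC. Qed.

HB.instance Definition _ := @isHermitianSesquilinear.Build _ _ _ _ csub_inner csub_inner_herm.

Fact csub_inner_gt0 x : x != 0 -> 0 < csub_inner x x.
Proof.
move=> x0; rewrite /csub_inner -norm_inner exprn_gt0// normr_gt0.
by apply: contra x0 => /eqP h; apply/eqP/val_inj; rewrite h raddf0.
Qed.

HB.instance Definition _ := @isDotProduct.Build _ _ csub_inner csub_inner_gt0.

Fact csub_norm_inner (x : csub_type) : `|x| ^+ 2 = csub_inner x x.
Proof. exact: norm_inner. Qed.

HB.instance Definition _ := isHilbert.Build R csub_type csub_norm_inner.

End Subspace.

(** * Norms as real numbers *)

Section RealNorm.
Variables (R : realType).

(** Norms take values in [R[i]], whose order is only partial; the real part gives access to the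
    total order of [R] and to linear arithmetic. *)
Definition rnorm (V : normedZmodType R[i]) (x : V) : R := complex.Re `|x|.

Section Generic.
Variable V : normedZmodType R[i].
Implicit Types x y : V.

Lemma rnormE x : `|x| = (rnorm x)%:C%C.
Proof. by rewrite RRe_real// ger0_real. Qed.

Lemma rnorm_ge0 x : 0 <= rnorm x.
Proof. by rewrite -ler0c -rnormE. Qed.

Lemma rnormD x y : rnorm (x + y) <= rnorm x + rnorm y.
Proof. by rewrite -lecR rmorphD/= -!rnormE ler_normD. Qed.

Lemma rnorm0 : rnorm (0 : V) = 0.
Proof. by rewrite /rnorm normr0. Qed.

Lemma rnorm_eq0 x : rnorm x = 0 -> x = 0.
Proof. by move=> x0; apply/eqP; rewrite -normr_eq0 rnormE x0. Qed.

Lemma rnorm_le0 x : rnorm x <= 0 -> x = 0.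
Proof. by move=> x0; apply: rnorm_eq0; apply/le_anti; rewrite x0 rnorm_ge0. Qed.

Lemma rnormN x : rnorm (- x) = rnorm x.
Proof. by rewrite /rnorm normrN. Qed.

Lemma rnormBC x y : rnorm (x - y) = rnorm (y - x).
Proof. by rewrite -rnormN opprB. Qed.

Lemma rnorm_sum I (r : seq I) (F : I -> V) :
  rnorm (\sum_(i <- r) F i) <= \sum_(i <- r) rnorm (F i).
Proof.
elim/big_rec2: _ => [|i u v _ le]; first by rewrite rnorm0.
by apply: le_trans (rnormD _ _) _; rewrite lerD2l.
Qed.

End Generic.

Lemma rnormM (a b : R[i]) : rnorm (a * b) = rnorm a * rnorm b.
Proof. by apply: (@complexI R); rewrite rmorphM/= -!rnormE normrM. Qed.

Lemma rnormZ (V : normedModType R[i]) a (x : V) : rnorm (a *: x) = rnorm a * rnorm x.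
Proof. by apply: (@complexI R); rewrite rmorphM/= -!rnormE normrZ. Qed.

Lemma rnorm_conj (a : R[i]) : rnorm a^* = rnorm a.
Proof. by rewrite /rnorm norm_conjC. Qed.

Lemma rnorm_real (a : R) : 0 <= a -> rnorm (a%:C)%C = a.
Proof. by move=> a0; rewrite /rnorm ger0_norm// ler0c. Qed.

Lemma mulCconj (a : R[i]) : a * a^* = ((rnorm a ^+ 2)%:C)%C.
Proof. by rewrite -normCK rnormE rmorphXn. Qed.

Lemma pos_complexE (e : R[i]) : 0 < e -> exists2 d : R, 0 < d & e = (d%:C)%C.
Proof.
move=> e0; exists (complex.Re e); last by rewrite RRe_real// gtr0_real.
by rewrite -ltcR RRe_real// gtr0_real.
Qed.

Section Hilbert.
Variable H : hilbertType R.
Implicit Types x y : H.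

Lemma innerE x : inner x x = ((rnorm x ^+ 2)%:C)%C.
Proof. by rewrite -norm_inner rnormE rmorphXn. Qed.

Lemma rnorm_inner x y : rnorm (inner x y) <= rnorm x * rnorm y.
Proof. by rewrite -lecR rmorphM/= -!rnormE cauchy_schwarz. Qed.

Lemma rparallelogram x y :
  rnorm (x + y) ^+ 2 + rnorm (x - y) ^+ 2 = 2 * (rnorm x ^+ 2 + rnorm y ^+ 2).
Proof.
have := parallelogram x y; rewrite !rnormE -!rmorphXn -!rmorphD.
by rewrite -[2](rmorph_nat (real_complex R)) -rmorphM => /complexI.
Qed.

Lemma cvg_rnormP (u : nat -> H) x :
  u @ \oo --> x <-> forall d : R, 0 < d -> \forall k \near \oo, rnorm (x - u k) < d.
Proof.
split=> [/cvgrPdist_lt ux d d0|ux].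
  have := ux (d%:C)%C; rewrite ltcR => /(_ d0); apply: filterS => k /=.
  by rewrite rnormE ltcR.
apply/cvgrPdist_lt => _ /pos_complexE[d d0 ->].
by apply: filterS (ux d d0) => k; rewrite rnormE ltcR.
Qed.

(** The rate bounds squared norms because the parallelogram law delivers it in this form. *)
Lemma cauchy_rate (u : nat -> H) (e : nat -> R) :
  (forall k l, (k <= l)%N -> rnorm (u k - u l) ^+ 2 <= e k) -> e @ \oo --> 0 ->
  exists x, u @ \oo --> x.
Proof.
move=> ue /cvgrPdist_lt e0; apply/cvg_ex/cauchy_cvgP/cauchyP.
move=> _ /pos_complexE[d d0 ->].
have [N _ hN] := e0 (d ^+ 2) (exprn_gt0 2 d0).
exists (u N); exists N => //= l Nl.
rewrite -ball_normE /ball_/= rnormE ltcR -(@ltr_pXn2r _ 2) ?nnegrE ?rnorm_ge0 ?ltW//.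
apply: le_lt_trans (ue _ _ Nl) _.
have := hN N (leqnn N); rewrite /= sub0r normrN; apply: le_lt_trans.
exact: ler_norm.
Qed.

End Hilbert.
End RealNorm.

(** * Orthogonal projection onto a closed subspace *)

Section Projection.
Variables (R : realType) (H : hilbertType R).
Implicit Types x y p q m : H.

Lemma rnorm_sub_proj x q : q != 0 ->
  rnorm (x - (inner x q / inner q q) *: q) ^+ 2 =
  rnorm x ^+ 2 - rnorm (inner x q) ^+ 2 / rnorm q ^+ 2.
Proof.
move=> q0; apply: (@complexI R).
have Q0 : inner q q != 0 by apply: contraNneq q0 => /inner_eq0 ->.
rewrite rmorphB/= fmorph_div/= -!innerE -mulCconj.
rewrite !(innerBl, innerBr, innerZl, innerZr) (innerC q x).
rewrite rmorphM fmorphV/= -(innerC q q).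
by field.
Qed.

(** A minimizing sequence [u] for the distance from [x] to [S] is Cauchy by the parallelogram law.
    Near-minimality makes [x - u k] almost orthogonal to [S], and the limit inherits exact
    orthogonality. *)
Lemma orth_proj (S : closedSubspace H) x :
  exists2 p, csub_set S p & forall q, csub_set S q -> inner (x - p) q = 0.
Proof.
pose E : set R := [set rnorm (x - m) ^+ 2 | m in csub_set S].
have Einf : has_inf E.
  split; first by exists (rnorm (x - 0) ^+ 2), 0 => //; exact: csub0.
  by exists 0 => _ [m _ <-]; rewrite exprn_ge0// rnorm_ge0.
have d_le m : csub_set S m -> inf E <= rnorm (x - m) ^+ 2.
  by move=> Sm; apply: ge_inf; [case: Einf | exists m].
have SZ a m : csub_set S m -> csub_set S (a *: m).
  by move=> Sm; rewrite -[_ *: _]addr0; apply: csubP => //; exact: csub0.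
have /choice[u uP] k : exists m, csub_set S m /\ rnorm (x - m) ^+ 2 < inf E + k.+1%:R^-1.
  have [|_ [m Sm <-] hm] := @inf_adherent R E k.+1%:R^-1 _ Einf; last by exists m.
  by rewrite invr_gt0 ltr0n.
(* Moving [u k] by the optimal multiple of [q] stays in [S], so the squared distance cannot drop
   below the infimum: the decrease given by [rnorm_sub_proj] is at most [k.+1%:R^-1]. *)
have almost_orth k q : csub_set S q -> rnorm (inner (x - u k) q) ^+ 2 <= k.+1%:R^-1 * rnorm q ^+ 2.
  move=> Sq; have [Sk dk] := uP k.
  have [->|q0] := eqVneq q 0; first by rewrite inner0r !rnorm0 expr0n/= mulr0.
  have Q0 : 0 < rnorm q ^+ 2.
    rewrite exprn_gt0// lt_def rnorm_ge0 andbT.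
    by apply: contraNneq q0 => /rnorm_eq0 ->.
  have := d_le _ (csubP (inner (x - u k) q / inner q q) Sq Sk).
  rewrite opprD addrCA addrC rnorm_sub_proj// lerBrDr => le.
  by rewrite -ler_pdivrMr// -(lerD2l (inf E)) (le_trans le (ltW dk)).
(* The midpoint of [u k] and [u l] lies in [S], so the parallelogram law bounds the left side by
   twice the sum of the two excesses over the infimum, each at most [k.+1%:R^-1]. *)
have u_cauchy k l : (k <= l)%N -> rnorm (u k - u l) ^+ 2 <= 4 * k.+1%:R^-1.
  move=> kl; have [Sk dk] := uP k; have [Sl dl] := uP l.
  have := rparallelogram (x - u k) (x - u l).
  have -> : x - u k - (x - u l) = - (u k - u l).
    by rewrite !opprB addrC addrA subrK.
  rewrite rnormN.
  have -> : x - u k + (x - u l) = 2 *: (x - ((1/2) *: u k + (1/2) *: u l)).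
    rewrite scalerBr scalerDr !scalerA mulrA mulr1 divff ?pnatr_eq0// !scale1r.
    by rewrite scaler_nat mulr2n opprD addrACA.
  rewrite rnormZ exprMn.
  have -> : rnorm (2 : R[i]) = 2.
    by rewrite -[X in rnorm X](rmorph_nat (real_complex R)) rnorm_real ?ler0n.
  have := d_le _ (csubP (1/2) Sk (SZ (1/2) _ Sl)).
  have : (l.+1%:R : R)^-1 <= k.+1%:R^-1 by rewrite lef_pV2 ?posrE ?ltr0n// ler_nat.
  move: (k.+1%:R^-1) (l.+1%:R^-1) dk dl => ek el; lra.
have [|p up] := cauchy_rate u_cauchy.
  by rewrite -(mulr0 4); apply: cvgMr; exact: cvg_harmonic.
exists p.
  apply: (@closed_cvg _ _ \oo _ u _ (csub_closed S) _ p up).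
  by apply: nearW => k; case: (uP k).
move=> q Sq; apply/rnorm_eq0/eqP/negPn/negP => c0.
set c := rnorm _ in c0; have {}c0 : 0 < c by rewrite lt_def c0 rnorm_ge0.
(* Two errors of size at most [D * rnorm q] each cannot add up to [c = 2 * D * (rnorm q + 1)]. *)
pose D := c / (2 * (rnorm q + 1)).
have q1 : 0 < rnorm q + 1 by rewrite ltr_wpDl ?rnorm_ge0.
have D0 : 0 < D by rewrite divr_gt0// mulr_gt0.
have cD : c = 2 * D * (rnorm q + 1).
  by rewrite /D; field; rewrite gt_eqF.
clearbody D.
have /cvg_rnormP/(_ D D0) hu := up.
have /cvgrPdist_lt/(_ (D ^+ 2) (exprn_gt0 2 D0)) hk := @cvg_harmonic R.
have [N _ /(_ N (leqnn N)) [/= uN]] := filterI hu hk.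
rewrite sub0r normrN gtr0_norm ?invr_gt0 ?ltr0n// => kN.
have : rnorm (inner (x - u N) q) <= D * rnorm q.
  rewrite -(@ler_pXn2r _ 2) ?nnegrE ?mulr_ge0 ?rnorm_ge0 ?(ltW D0)// exprMn.
  apply: le_trans (almost_orth _ _ Sq) _.
  by rewrite ler_wpM2r ?exprn_ge0 ?rnorm_ge0 ?(ltW kN).
have : rnorm (inner (u N - p) q) <= D * rnorm q.
  apply: le_trans (rnorm_inner _ _) _.
  by rewrite ler_wpM2r ?rnorm_ge0// rnormBC ltW.
have : c <= rnorm (inner (x - u N) q) + rnorm (inner (u N - p) q).
  by rewrite (le_trans _ (rnormD _ _))// -innerDl addrA subrK.
rewrite cD; lra.
Qed.

End Projection.

(** * Bounded operators, Riesz representation and adjoints *)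

Section BoundedOperators.
Variables (R : realType).

(** If [f x] were nonzero at a point [x] of the closure, a zero [y] within distance
    [rnorm (f x) / (|M| + 1)] would make [f x = f (x - y)] smaller than itself. *)
Lemma closed_bounded_ker (H : hilbertType R) (V : normedZmodType R[i])
    (f : H -> V) (M : R) :
  (forall x y, f (x - y) = f x - f y) ->
  (forall x, rnorm (f x) <= M * rnorm x) -> closed [set x | f x = 0].
Proof.
move=> fB fM x clx; apply/rnorm_le0; rewrite leNgt; apply/negP => fx.
have M1 : 0 < `|M| + 1 by rewrite ltr_wpDl.
have [] := clx (ball x (rnorm (f x) / (`|M| + 1))%:C%C).
  by apply: nbhsx_ballx; rewrite ltcR divr_gt0.
move=> y [/= fy]; rewrite -ball_normE /ball_/= rnormE ltcR => xy.
have : rnorm (f x) <= `|M| * rnorm (x - y).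
  rewrite -[f x]subr0 -fy -fB; apply: le_trans (fM _) _.
  by rewrite ler_wpM2r ?rnorm_ge0// ler_norm.
have : rnorm (x - y) * (`|M| + 1) < rnorm (f x) by rewrite -ltr_pdivlMr.
have := rnorm_ge0 (x - y); lra.
Qed.

Section Construct.
Variables (V W : normedModType R[i]) (f : V -> W).
Hypothesis f_lin : linear f.

(** The [let] makes the linearity proof a parameter of the definition, so that the linear structure
    can be inferred from the term. *)
Definition linear_fun_of := let _ := f_lin in f.
HB.instance Definition _ := GRing.isLinear.Build R[i] V W *:%R linear_fun_of f_lin.

Variable M : R.
Hypothesis f_bound : forall x, rnorm (f x) <= M * rnorm x.

Lemma linear_fun_of_continuous : continuous linear_fun_of.
Proof.
apply: bounded_linear_continuous; apply/linear_boundedP.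
exists (M%:C)%C; split; first by apply/complex_realP; exists M.
move=> r Mr x; rewrite rnormE; apply: (@le_trans _ _ ((M * rnorm x)%:C)%C).
  by rewrite lecR f_bound.
by rewrite rmorphM/= rnormE ler_wpM2r ?(ltW Mr)// ler0c rnorm_ge0.
Qed.

End Construct.

Definition bounded_op_of (H K : hilbertType R) (f : H -> K) (f_lin : linear f) M
    (f_bound : forall x, rnorm (f x) <= M * rnorm x) : boundedOp H K :=
  BoundedOp (@linear_fun_of_continuous H K f f_lin M f_bound).

Lemma boundedOpZ (H K : hilbertType R) (A : boundedOp H K) a x :
  A (a *: x) = a *: A x.
Proof. exact: linearZZ. Qed.

Lemma boundedOp_bound (H K : hilbertType R) (A : boundedOp H K) :
  exists2 M : R, 0 <= M & forall x, rnorm (A x) <= M * rnorm x.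
Proof.
have /linear_bounded_continuous/linear_boundedP := @bop_continuous _ _ _ A.
move=> /pinfty_ex_gt0[_ /pos_complexE[M M0 ->] AM]; exists M; first exact: ltW.
by move=> x; rewrite -lecR rmorphM/= -!rnormE.
Qed.

(** Unless [f] is zero, some [e] orthogonal to the closed kernel has [f e] nonzero. Every
    [x - (f x / f e) *: e] lies in the kernel, and pairing it with [e] determines [f x]. *)
Lemma riesz (H : hilbertType R) (f : H -> R[i]) (M : R) :
  (forall (a : R[i]) x y, f (a *: x + y) = a * f x + f y) ->
  (forall x, rnorm (f x) <= M * rnorm x) ->
  exists y, forall x, f x = inner x y.
Proof.
move=> f_lin f_bound.
have fB x y : f (x - y) = f x - f y by rewrite addrC -scaleN1r f_lin mulN1r addrC.
have f0 : f 0 = 0 by rewrite -[X in f X](subrr 0) fB subrr.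
pose S := @ClosedSubspace R H [set x | f x = 0] f0
  (fun a x y (fx : f x = 0) (fy : f y = 0) => etrans (f_lin a x y)
     (etrans (congr2 (fun u v => a * u + v) fx fy) (etrans (addr0 _) (mulr0 a))))
  (closed_bounded_ker fB f_bound).
have [f00|/existsNP[x0 /eqP fx0]] := pselect (forall x, f x = 0).
  by exists 0 => x; rewrite f00 inner0r.
have [p fp ortho] := orth_proj S x0.
set e := x0 - p in ortho.
have fe : f e = f x0 by rewrite fB (fp : f p = 0) subr0.
have e0 : inner e e != 0.
  apply: contraNneq fx0 => /inner_eq0 e0; by rewrite -fe e0 f0.
exists ((f e / inner e e)^* *: e) => x.
rewrite innerZr conjCK.
have : inner e (x - (f x / f e) *: e) = 0.
  apply: ortho; change (f (x - (f x / f e) *: e) = 0).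
  by rewrite fB -[_ *: e]addr0 f_lin f0 addr0 divfK ?subrr// fe.
rewrite innerC => /eqP; rewrite conjC_eq0 innerBl innerZl subr_eq0 => /eqP ->.
by field; rewrite fe fx0 e0.
Qed.

(** Riesz representation of [x |-> <A x, y>] gives [B y]; the bound follows from
    [|B y|^2 = <A (B y), y>] after cancelling [|B y|]. *)
Lemma adjoint_exists (H K : hilbertType R) (A : boundedOp H K) :
  exists B : boundedOp K H, adjoint_of A B.
Proof.
have [M M0 AM] := boundedOp_bound A.
have /choice[B AB] y : exists z, forall x, inner (A x) y = inner x z.
  apply: (@riesz H _ (M * rnorm y)) => [a x x'|x].
    by rewrite linearP innerDl innerZl.
  by rewrite (le_trans (rnorm_inner _ _))// mulrAC ler_wpM2r ?rnorm_ge0.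
have B_lin : linear B.
  move=> a y z; apply: inner_eqP => x.
  rewrite innerC -AB innerDr innerZr !AB innerDl innerZl.
  by rewrite rmorphD rmorphM/= conjCK -!(innerC _ x).
have BM y : rnorm (B y) <= M * rnorm y.
  have [->|] := eqVneq (rnorm (B y)) 0; first by rewrite mulr_ge0 ?rnorm_ge0.
  move=> b0; have {}b0 : 0 < rnorm (B y) by rewrite lt_def b0 rnorm_ge0.
  rewrite -(ler_pM2r b0).
  apply: (@le_trans _ _ (rnorm (inner (A (B y)) y))).
    by rewrite AB innerE rnorm_real ?exprn_ge0 ?rnorm_ge0// expr2.
  apply: le_trans (rnorm_inner _ _) _.
  by rewrite mulrAC ler_wpM2r ?rnorm_ge0.
by exists (bounded_op_of B_lin BM) => x y; rewrite /= /linear_fun_of AB.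
Qed.

Lemma adjoint_sym (H K : hilbertType R) (A : boundedOp H K) B :
  adjoint_of A B -> adjoint_of B A.
Proof. by move=> AB x y; rewrite innerC -AB -innerC. Qed.

End BoundedOperators.

(** A quadratic remainder is little-o: for [|h| < e / C] it is at most [e * |h|]. *)
Lemma differentiable_remainder (K : numFieldType) (V W : normedModType K)
    (f : V -> W) (df : {linear V -> W}) (x : V) (C d : K) :
  continuous df -> 0 < d -> 0 < C ->
  (forall h, `|h| < d -> `|f (h + x) - f x - df h| <= C * `|h| ^+ 2) ->
  differentiable f x.
Proof.
move=> dfc d0 C0 rem.
have eqf : f \o shift x = cst (f x) + df +o_ 0 id.
  apply/eqaddoP => e e0.
  have dC : 0 < e / C by rewrite divr_gt0.
  near=> h.
  have hd : `|h| < d by near: h; apply: nbhs0_lt.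
  have hC : `|h| < e / C by near: h; apply: nbhs0_lt.
  rewrite [X in `|X|](_ : _ = f (h + x) - f x - df h); last first.
    by rewrite /= !fctE /= opprD addrA.
  apply: le_trans (rem h hd) _.
  rewrite expr2 mulrA ler_wpM2r// mulrC -ler_pdivlMr// ltW//.
have dE := diff_unique dfc eqf.
by apply/diff_locallyP; rewrite dE.
Unshelve. all: by end_near. Qed.

(** * Row partial isometries *)

Section PartialIsometry.
Variables (R : realType) (n : nat).

Lemma row_opB (H : hilbertType R) (T : optuple n H) g h :
  row_op T (fun i => g i - h i) = row_op T g - row_op T h.
Proof. by rewrite /row_op -sumrB; apply: eq_bigr => i _; rewrite raddfB. Qed.

Lemma row_op_adjoint (H : hilbertType R) (T T' : optuple n H) h y :
  (forall i, adjoint_of (T i) (T' i)) ->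
  inner (row_op T h) y = power_inner h (fun i => T' i y).
Proof. by move=> adjT; rewrite inner_suml; apply: eq_bigr => i _; rewrite adjT. Qed.

Lemma power_innerC (H : hilbertType R) (g h : 'I_n -> H) :
  power_inner g h = (power_inner h g)^*.
Proof. by rewrite rmorph_sum/=; apply: eq_bigr => i _; rewrite -innerC. Qed.

Lemma power_innerB (H : hilbertType R) (f g h : 'I_n -> H) :
  power_inner f (fun i => g i - h i) = power_inner f g - power_inner f h.
Proof. by rewrite -sumrB; apply: eq_bigr => i _; rewrite innerBr. Qed.

Lemma power_inner_eq0 (H : hilbertType R) (h : 'I_n -> H) :
  power_inner h h = 0 -> forall i, h i = 0.
Proof.
move=> h0 i; apply: inner_eq0.
by apply: (psumr_eq0P (F := fun i => inner (h i) (h i)) _ h0) => // j _; exact: inner_ge0.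
Qed.

Section Adjoint.
Variables (H : hilbertType R) (T T' : optuple n H).
Hypothesis adjT : forall i, adjoint_of (T i) (T' i).

Definition row_gram (y : H) : H := row_op T (fun i => T' i y).
Local Notation Q := row_gram.

Lemma row_gramB y z : Q (y - z) = Q y - Q z.
Proof.
by rewrite /Q -row_opB; apply: eq_bigr => i _; rewrite raddfB.
Qed.

Lemma row_gramD y z : Q (y + z) = Q y + Q z.
Proof.
by rewrite /row_gram /row_op -big_split; apply: eq_bigr => i _; rewrite !raddfD.
Qed.

Lemma row_gram_inner y z : inner (Q y) z = power_inner (fun i => T' i y) (fun i => T' i z).
Proof. by rewrite (row_op_adjoint _ _ adjT). Qed.

Lemma row_gram_sym y z : inner (Q y) z = inner y (Q z).
Proof. by rewrite row_gram_inner power_innerC -row_gram_inner -innerC. Qed.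

Lemma row_gram_kernel y : Q y = 0 -> forall i, T' i y = 0.
Proof.
by move=> Qy; apply: (@power_inner_eq0 H (fun i => T' i y)); rewrite -row_gram_inner Qy inner0l.
Qed.

(* T' y is orthogonal to ker T, so <Q y, Q y> = <Q y, y>: the self-adjoint
   operator Q - Q^2 has zero quadratic form. *)
Lemma row_gram_idem : partial_isometry (@power_inner R n H) (row_op T) ->
  forall y, Q (Q y) = Q y.
Proof.
move=> Tpi.
pose G y := Q y - Q (Q y).
have GB y z : G (y + z) = G y + G z.
  by rewrite /G !row_gramD opprD addrACA.
have G_sym y z : inner (G y) z = inner y (G z).
  by rewrite /G innerBl innerBr !row_gram_sym.
have Gyy y : inner (G y) y = 0.
  rewrite innerBl row_gram_sym [inner (Q (Q y)) _]row_gram_sym.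
  rewrite (Tpi (fun i => T' i y)) ?row_gram_sym -?row_gram_inner ?row_gram_sym ?subrr// => g Tg.
  by rewrite power_innerC -(row_op_adjoint _ _ adjT) Tg inner0l conjC0.
have GE y : G y = Q y - Q (Q y) by [].
clearbody G; move=> y; apply/esym/eqP; rewrite -subr_eq0 -GE; apply/eqP/inner_eq0.
have := Gyy (y + G y).
rewrite GB !(innerDl, innerDr) !Gyy add0r addr0 [inner (G (G y)) y]G_sym => /eqP.
by rewrite -mulr2n mulrn_eq0 /= => /eqP.
Qed.

(** If [T] is a partial isometry, idempotence puts [z - Q z] in the kernel of [Q], which is that of
    all [T' i], so it is orthogonal to the range of [T]. Conversely [T' T x - x] lies in [ker T],
    and orthogonality of [x] to it is the isometry relation. *)
Lemma partial_isometryP :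
  partial_isometry (@power_inner R n H) (row_op T) <->
  forall h, Q (row_op T h) = row_op T h.
Proof.
split=> [Tpi h|QT x xker]; last first.
  have /eqP : power_inner x (fun i => T' i (row_op T x) - x i) = 0.
    by apply: xker; rewrite row_opB (QT x : row_op T _ = _) subrr.
  by rewrite power_innerB subr_eq0 -(row_op_adjoint _ _ adjT) => /eqP.
apply: inner_eqP => z; apply/eqP; rewrite eq_sym -subr_eq0 row_gram_sym -innerBr.
rewrite (row_op_adjoint _ _ adjT) /power_inner big1// => i _.
rewrite row_gram_kernel ?inner0r//.
by rewrite row_gramB row_gram_idem// subrr.
Qed.

End Adjoint.

Lemma adjoint_tuple_exists (H : hilbertType R) (T : optuple n H) :
  exists T' : optuple n H, forall i, adjoint_of (T i) (T' i).
Proof.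
have /choice[T' adjT] i : exists B, adjoint_of (T i) B by exact: adjoint_exists.
by exists T'.
Qed.

Lemma spherical_partial_isometry (H : hilbertType R) (S : optuple n H) :
  spherical_coisometry S -> partial_isometry (@power_inner R n H) (row_op S).
Proof. by case=> _ [S' adjS S1]; apply/(partial_isometryP adjS) => h; exact: S1. Qed.

Lemma unitary_partial_isometry (H K : hilbertType R) (S : optuple n H) (T : optuple n K) :
  unitarily_equivalent S T -> partial_isometry (@power_inner R n K) (row_op T) ->
  partial_isometry (@power_inner R n H) (row_op S).
Proof.
move=> [U [Uiso Usurj] US] Tpi x xker.
have UST h : U (row_op S h) = row_op T (fun i => U (h i)).
  by rewrite /row_op raddf_sum; apply: eq_bigr => i _; exact: US.
have UP f g : power_inner (fun i => U (f i)) (fun i => U (g i)) = power_inner f g.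
  by apply: eq_bigr => i _; rewrite Uiso.
rewrite -Uiso UST Tpi ?UP// => y Ty.
have /choice[g gy] i := Usurj (y i).
have -> : y = fun i => U (g i) by apply/funext => i; rewrite gy.
rewrite UP; apply: xker; apply: inner_eq0; rewrite -Uiso UST.
have -> : (fun i => U (g i)) = y by apply/funext => i; rewrite gy.
by rewrite Ty inner0l.
Qed.

Lemma direct_sum_partial_isometry (H H0 H1 : hilbertType R)
    (T : optuple n H) (T0 : optuple n H0) (T1 : optuple n H1) :
  is_direct_sum T T0 T1 ->
  partial_isometry (@power_inner R n H0) (row_op T0) ->
  partial_isometry (@power_inner R n H1) (row_op T1) ->
  partial_isometry (@power_inner R n H) (row_op T).
Proof.
move=> [J [Jiso Jsurj TJ]] pi0 pi1 x xker.
have TJrow p : row_op T (fun i => J (p i)) =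
    J (row_op T0 (fun i => (p i).1), row_op T1 (fun i => (p i).2)).
  rewrite /row_op (eq_bigr (fun i => J (T0 i (p i).1, T1 i (p i).2))) => [|i _]; last exact: TJ.
  rewrite -raddf_sum; congr (J _).
  by rewrite [LHS]surjective_pairing !raddf_sum.
have JP p q : power_inner (fun i => J (p i)) (fun i => J (q i)) =
    power_inner (fun i => (p i).1) (fun i => (q i).1) +
    power_inner (fun i => (p i).2) (fun i => (q i).2).
  by rewrite -big_split; apply: eq_bigr => i _; exact: Jiso.
have /choice[p px] i := Jsurj (x i).
have xE : x = fun i => J (p i) by apply/funext => i; rewrite px.
rewrite xE TJrow JP Jiso /=; congr (_ + _).
(* A tuple [y] in the kernel of [T0] is tested through the pairs [(y i, 0)], which [J] carries into
   the kernel of [T]. *)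
- apply: pi0 => y y0; have := xker (fun i => J (y i, 0)).
  rewrite xE TJrow JP /= y0 /row_op big1 => [|i _]; last by rewrite raddf0.
  rewrite -[(0, 0)]/(0 : H0 * H1)%type raddf0 => /(_ erefl).
  by rewrite {2}/power_inner [X in _ + X]big1 ?addr0// => i _; rewrite inner0r.
- apply: pi1 => y y0; have := xker (fun i => J (0, y i)).
  rewrite xE TJrow JP /= y0 /row_op big1 => [|i _]; last by rewrite raddf0.
  rewrite -[(0, 0)]/(0 : H0 * H1)%type raddf0 => /(_ erefl).
  by rewrite {1}/power_inner [X in X + _]big1 ?add0r// => i _; rewrite inner0r.
Qed.

End PartialIsometry.

(** * The row of coordinate multiplications on the Drury-Arveson space *)

Section DruryArveson.
Variables (R : realType) (n : nat).

Lemma enorm_sqr (z : 'rV[R[i]]_n) : enorm z ^+ 2 = ((\sum_(i < n) rnorm (z 0 i) ^+ 2)%:C)%C.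
Proof.
by rewrite sqrtCK /cdot rmorph_sum; apply: eq_bigr => i _; rewrite mulCconj.
Qed.

Lemma enorm_ltP (z : 'rV[R[i]]_n) (e : R) : 0 < e ->
  (enorm z < (e%:C)%C) = (\sum_(i < n) rnorm (z 0 i) ^+ 2 < e ^+ 2).
Proof.
move=> e0; rewrite -(@ltr_pXn2r _ 2) ?nnegrE ?ler0c ?(ltW e0)//.
  by rewrite enorm_sqr -rmorphXn ltcR.
by rewrite sqrtC_ge0 /cdot sumr_ge0// => i _; rewrite mul_conjC_ge0.
Qed.

Lemma unit_ballE (z : 'rV[R[i]]_n) : unit_ball z = (\sum_(i < n) rnorm (z 0 i) ^+ 2 < 1) :> Prop.
Proof. by rewrite /unit_ball/= -[1]/(1%:C)%C enorm_ltP// expr1n. Qed.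

Lemma unit_ball0 : unit_ball (0 : 'rV[R[i]]_n).
Proof. by rewrite unit_ballE big1// => i _; rewrite mxE rnorm0 expr0n. Qed.

(** Termwise, [|z_i w_i|] is at most the mean of the two squares, so [|<z, w>|] is at most the mean
    of [|z|^2] and [|w|^2], which is below 1. *)
Lemma cdot_neq1 (z w : 'rV[R[i]]_n) : unit_ball z -> unit_ball w -> 1 - cdot z w != 0.
Proof.
rewrite !unit_ballE => z1 w1; rewrite subr_eq0; apply: contraTneq z1 => zw.
have : 1 <= \sum_(i < n) (rnorm (z 0 i) ^+ 2 + rnorm (w 0 i) ^+ 2) / 2.
  have c1 : rnorm (cdot z w) = 1 by rewrite -zw -[1]/(1%:C)%C rnorm_real.
  rewrite -{1}c1; apply: le_trans (rnorm_sum _ _) _; apply: ler_sum => i _.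
  rewrite rnormM rnorm_conj.
  have := sqr_ge0 (rnorm (z 0 i) - rnorm (w 0 i)); rewrite sqrrB; lra.
rewrite -mulr_suml big_split/=; lra.
Qed.

Section Rkhs.
Variables (X : Type) (A : set X) (D F : hilbertType R) (ev : F -> X -> D).
Variables (k : X -> X -> D -> D).
Hypothesis rk : is_rkhs A ev k.

Lemma rkhs0 z : A z -> ev 0 z = 0.
Proof.
by move=> Az; have := rkhs_linear rk (-1) 0 0 Az; rewrite !scaleN1r oppr0 addr0 addNr.
Qed.

Lemma rkhsZ a f z : A z -> ev (a *: f) z = a *: ev f z.
Proof. by move=> Az; have := rkhs_linear rk a f 0 Az; rewrite rkhs0// !addr0. Qed.

Lemma rkhsB f g z : A z -> ev (f - g) z = ev f z - ev g z.
Proof. by move=> Az; rewrite addrC -scaleN1r (rkhs_linear rk)// scaleN1r addrC. Qed.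

Lemma rkhs_sum m (f : 'I_m -> F) z : A z ->
  ev (\sum_(i < m) f i) z = \sum_(i < m) ev (f i) z.
Proof.
move=> Az; elim/big_rec2: _ => [|i u v _ <-]; first exact: rkhs0.
by have := rkhs_linear rk 1 (f i) v Az; rewrite !scale1r.
Qed.

End Rkhs.

(** Since [M' i] multiplies [k_w x] by the conjugate of [w_i], the value of [M M' (k_w x)] at [z] is
    [<z, w> / (1 - <z, w>)] times [x], which is that of [k_w x - k_0 x]. Vectors in the range of [M]
    vanish at 0, so [M M'] fixes them. *)
Lemma drury_arveson_partial_isometry (D F : hilbertType R)
    (ev : F -> 'rV[R[i]]_n -> D) (M : optuple n F) :
  is_drury_arveson ev -> is_mult_tuple ev M ->
  partial_isometry (@power_inner R n F) (row_op M).
Proof.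
move=> [rk _] mult.
have [M' adjM] := adjoint_tuple_exists M.
apply/(partial_isometryP adjM) => h.
have ev_row g z : unit_ball z -> ev (row_op M g) z = \sum_(i < n) z 0 i *: ev (g i) z.
  by move=> z1; rewrite (rkhs_sum rk)//; apply: eq_bigr => i _; rewrite mult.
apply: (rkhs_injective rk) => w w1; apply: inner_eqP => x.
have [kw kwE kwP] := rkhs_reproducing rk x w1.
have [k0 k0E k0P] := rkhs_reproducing rk x unit_ball0.
have M'kw i : M' i kw = (w 0 i)^* *: kw.
  apply: inner_eqP => g; rewrite innerC -adjM kwP mult// innerZl -kwP.
  by rewrite rmorphM/= -innerC innerZl.
have row_kw : row_op M (fun i => M' i kw) = kw - k0.
  apply: (rkhs_injective rk) => z z1; rewrite (rkhsB rk)// ev_row// kwE// k0E//.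
  under eq_bigr => i _ do rewrite M'kw (rkhsZ rk)// kwE// scalerA.
  rewrite -scaler_suml -/(cdot z w) scalerA -scalerBl; congr (_ *: _).
  have -> : cdot z 0 = 0.
    by rewrite /cdot big1// => i _; rewrite mxE conjC0 mulr0.
  by field; rewrite cdot_neq1//= subr0 oner_eq0.
rewrite -kwP row_gram_sym// /row_gram row_kw innerBr kwP k0P.
rewrite [ev _ 0]ev_row; last exact: unit_ball0.
by rewrite [X in _ - inner X x]big1 ?inner0l ?subr0// => i _; rewrite mxE scale0r.
Qed.

End DruryArveson.

(** * Resolvents *)

(* Pairing with an arbitrary vector turns an identity between linear
   combinations of vectors into one that ring can decide. *)
Ltac lincomb :=
  apply: inner_eqP => ?;
  rewrite ?(inner0l, innerBl, innerDl, innerNl, innerZl); ring.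

Section Resolvent.
Variables (R : realType) (H : hilbertType R).

Lemma expr_small (r c : R) : 0 <= r -> r < 1 -> (forall k, c <= r ^+ k) -> c <= 0.
Proof.
move=> r0 r1 cr; rewrite leNgt; apply/negP => c0.
have /cvgrPdist_lt/(_ c c0)[N _ /(_ N (leqnn N))] : (r ^+ k) @[k --> \oo] --> (0 : R).
  by apply: cvg_expr; rewrite ger0_norm.
by rewrite /= sub0r normrN ger0_norm ?exprn_ge0// ltNge cr.
Qed.

Lemma small_eq0 (c C d : R) : 0 < d -> 0 <= c ->
  (forall t : R, 0 < t -> t < d -> c <= t * C) -> c = 0.
Proof.
move=> d0 c0 le; apply/eqP; rewrite eq_sym eq_le c0/= leNgt; apply/negP => cp.
have C1 : 0 < `|C| + 1 by rewrite ltr_wpDl.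
(* The second entry makes [t * C] at most [c / 2], contradicting [c <= t * C]. *)
pose t := Num.min (d / 2) (c / (2 * (`|C| + 1))).
have tP : 0 < t by rewrite /t lt_min !divr_gt0// mulr_gt0.
have td : t < d.
  by apply: (@le_lt_trans _ _ (d / 2)); [rewrite /t ge_min lexx | lra].
have tc : t <= c / (2 * (`|C| + 1)) by rewrite /t ge_min lexx orbT.
have := le t tP td.
have : t * C <= t * (`|C| + 1).
  by rewrite ler_pM2l// (le_trans (ler_norm _))// lerDl.
have : t * (`|C| + 1) <= c / 2.
  have -> : c / 2 = c / (2 * (`|C| + 1)) * (`|C| + 1) by field; rewrite gt_eqF.
  by rewrite ler_pM2r.
lra.
Qed.

Variables (L : {linear H -> H}) (r : R).
Hypothesis L_bound : forall h, rnorm (L h) <= r * rnorm h.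

Lemma resolvent_bound u f : r < 1 -> u - L u = f -> rnorm u <= rnorm f / (1 - r).
Proof.
move=> r1 uf; rewrite ler_pdivlMr ?subr_gt0// mulrBr mulr1 lerBlDr mulrC.
apply: le_trans (_ : rnorm (f + L u) <= _); first by rewrite -uf subrK.
by apply: le_trans (rnormD _ _) _; rewrite lerD2l.
Qed.

Lemma resolvent_uniq u v : r < 1 -> u - L u = v - L v -> u = v.
Proof.
move=> r1 uv; apply/eqP; rewrite -subr_eq0; apply/eqP/rnorm_le0.
have : u - v - L (u - v) = 0.
  rewrite raddfB; transitivity (u - L u - (v - L v)); last by rewrite uv subrr.
  lincomb.
by move/(resolvent_bound r1); rewrite rnorm0 mul0r.
Qed.

(** The iterates [u k] of [v |-> f + L v] from 0 are the partial sums of the Neumann series; their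
    limit is the solution. *)
Lemma resolvent_solve f : 0 <= r -> r < 1 -> exists u, u - L u = f.
Proof.
move=> r0 r1; have r1' : 0 < 1 - r by rewrite subr_gt0.
pose u k := iter k (fun v => f + L v) 0.
pose c := rnorm f / (1 - r).
have c0 : 0 <= c by rewrite divr_ge0 ?rnorm_ge0// ltW.
(* The radius [c] satisfies [|f| + r * c = c], so the iteration preserves the ball of radius [c]. *)
have fc : rnorm f = c - r * c by rewrite /c; field; rewrite gt_eqF.
have u_bd k : rnorm (u k) <= c.
  elim: k => [|k IH]; first by rewrite rnorm0.
  apply: le_trans (rnormD _ _) _; rewrite fc -lerBrDl opprB addrC subrK.
  by apply: le_trans (L_bound _) _; rewrite ler_wpM2l.
have u_step k l : (k <= l)%N -> rnorm (u k - u l) <= r ^+ k * c.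
  elim: k l => [|k IH] [|l] //.
  - by move=> _; rewrite subrr rnorm0 expr0 mul1r.
  - by move=> _; rewrite expr0 mul1r sub0r rnormN.
  rewrite ltnS => /IH kl.
  have -> : u k.+1 - u l.+1 = L (u k - u l).
    by rewrite /u/= opprD addrACA subrr add0r raddfB.
  by apply: le_trans (L_bound _) _; rewrite exprS -mulrA ler_wpM2l.
have rate k l : (k <= l)%N -> rnorm (u k - u l) ^+ 2 <= c ^+ 2 * (r ^+ 2) ^+ k.
  move=> /u_step kl; rewrite -exprM mulnC exprM -exprMn mulrC.
  by rewrite ler_pXn2r ?nnegrE ?rnorm_ge0// mulr_ge0// exprn_ge0.
have rate0 : (c ^+ 2 * (r ^+ 2) ^+ k) @[k --> \oo] --> (0 : R).
  rewrite -(mulr0 (c ^+ 2)); apply: cvgMr; apply: cvg_expr.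
  by rewrite ger0_norm ?exprn_ge0// expr_lt1.
have [x ux] := cauchy_rate rate rate0.
exists x; apply/eqP; rewrite subr_eq -subr_eq0; apply/eqP/rnorm_le0.
rewrite leNgt; apply/negP; set e := rnorm _ => e0.
have /cvg_rnormP/(_ (e / 2))[|N _ hN] := ux; first by rewrite divr_gt0.
have h0 := hN N (leqnn N); have h1 := hN N.+1 (leqnSn N).
have : e <= rnorm (x - u N.+1) + rnorm (L (x - u N)).
  rewrite -(rnormN (L _)) (le_trans _ (rnormD _ _))// le_eqVlt; apply/orP; left.
  apply/eqP; rewrite /e raddfB /=; congr rnorm; lincomb.
have : rnorm (L (x - u N)) <= rnorm (x - u N).
  by apply: le_trans (L_bound _) _; rewrite ler_piMl ?rnorm_ge0// ltW.
rewrite /= in h0 h1; lra.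
Qed.

(** The inverse is packaged as a bounded operator because the kernel vectors of the model come from
    its adjoint. *)
Lemma resolvent_exists : 0 <= r -> r < 1 -> exists B : boundedOp H H,
  (forall f, B f - L (B f) = f) /\ (forall f, B (f - L f) = f).
Proof.
move=> r0 r1.
have /choice[B BP] f : exists u, u - L u = f by exact: resolvent_solve.
have B_lin : linear B.
  move=> a f g; apply: resolvent_uniq => //.
  by rewrite BP linearP opprD addrACA -scalerBr !BP.
have B_bd f : rnorm (B f) <= (1 - r)^-1 * rnorm f.
  by rewrite mulrC; apply: resolvent_bound => //; exact: BP.
by exists (bounded_op_of B_lin B_bd); split=> f //; apply: resolvent_uniq.
Qed.

Lemma iter_linear_bound k h : 0 <= r -> rnorm (iter k L h) <= r ^+ k * rnorm h.
Proof.
move=> r0; elim: k => [|k IH]; first by rewrite expr0 mul1r.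
by rewrite iterS exprS -mulrA (le_trans (L_bound _))// ler_wpM2l.
Qed.

End Resolvent.

(** * Coefficients of the Neumann series *)

Section Coefficients.
Variables (R : realType) (H : hilbertType R) (L P : {linear H -> H}) (r : R).
Hypothesis L_bound : forall h, rnorm (L h) <= r * rnorm h.
Hypothesis P_bound : forall h, rnorm (P h) <= rnorm h.

(* By (1 - tL)^-1 c = c + t (1 - tL)^-1 L c, the hypothesis for [c] implies
   [P c = 0] as t tends to 0, and then the same hypothesis for [L c]. *)
Lemma coefs_of_resolvent (d : R) c : 0 <= r -> 0 < d ->
  (forall (t : R) u, 0 < t -> t < d -> u - (t%:C)%C *: L u = c -> P u = 0) ->
  forall k, P (iter k L c) = 0.
Proof.
move=> r0 d0; have base c' :
    (forall (t : R) u, 0 < t -> t < d -> u - (t%:C)%C *: L u = c' -> P u = 0) -> P c' = 0.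
  move=> kill; apply: rnorm_eq0.
  have r1 : 0 < 2 * (r + 1) by rewrite mulr_gt0// ltr_wpDl.
  (* Below [(2 * (r + 1))^-1] the operator [t L] has norm at most 1/2, so [u] exists and is at most
     twice as large as [c']. *)
  have d1 : 0 < Num.min d (2 * (r + 1))^-1 by rewrite lt_min d0 invr_gt0.
  apply: (@small_eq0 _ _ (2 * r * rnorm c') _ d1 (rnorm_ge0 _)) => t t0.
  rewrite lt_min => /andP[td tr].
  have tr2 : t * r <= 1 / 2.
    have : t * (2 * (r + 1)) < 1 by rewrite -ltr_pdivlMr// div1r.
    have := mulr_ge0 (ltW t0) r0; lra.
  have tL h : rnorm ((t%:C)%C *: L h) <= (1 / 2) * rnorm h.
    rewrite rnormZ rnorm_real ?(ltW t0)//.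
    apply: le_trans (ler_wpM2l (ltW t0) (L_bound h)) _.
    by rewrite mulrA ler_wpM2r ?rnorm_ge0.
  have [||u /= uc] := @resolvent_solve _ _ ((t%:C)%C \*: L : {linear H -> H}) (1 / 2) tL c'.
  - lra.
  - lra.
  have Pu := kill t u t0 td uc.
  have u2 : rnorm u <= 2 * rnorm c'.
    have : rnorm u <= rnorm c' + rnorm ((t%:C)%C *: L u).
      by rewrite (le_trans _ (rnormD _ _))// -uc subrK.
    have := tL u; lra.
  have -> : P c' = - ((t%:C)%C *: P (L u)) by rewrite -uc raddfB /= linearZ /= Pu sub0r.
  rewrite rnormN rnormZ rnorm_real ?(ltW t0)// ler_wpM2l ?(ltW t0)//.
  apply: le_trans (P_bound _) _; apply: le_trans (L_bound _) _.
  by rewrite [2 * r]mulrC -mulrA ler_wpM2l.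
move=> kill k; elim: k c kill => [|k IH] c' kill; first exact: base.
rewrite iterSr; apply: IH => t v t0 td vc.
have : P (c' + (t%:C)%C *: v) = 0.
  apply: (kill t) => //.
  have -> : L (c' + (t%:C)%C *: v) = L c' + (t%:C)%C *: L v by rewrite linearD linearZ.
  transitivity (c' + (t%:C)%C *: (v - (t%:C)%C *: L v - L c')); first by lincomb.
  by rewrite vc subrr scaler0 addr0.
rewrite raddfD /= (base _ kill) add0r linearZ => /eqP.
by rewrite scaler_eq0 eq_complex /= (gt_eqF t0) => /eqP.
Qed.

(** Applying [P L^k] to [u - L u = c] gives [P L^k u = P L^(k+1) u]. Hence [P u = P L^k u] for every
    [k], and the right side has norm at most [r^k |u|]; no infinite series is summed. *)
Lemma resolvent_of_coefs c u : 0 <= r -> r < 1 -> u - L u = c ->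
  (forall k, P (iter k L c) = 0) -> P u = 0.
Proof.
move=> r0 r1 uc Pc.
have PL k : P u = P (iter k L u).
  elim: k => [//|k ->]; apply/eqP; rewrite -subr_eq0 -raddfB /= -(Pc k) -uc.
  apply/eqP; congr (P _).
  by elim: k => [//|k IH]; rewrite !iterS -IH raddfB.
have [u0|u0] := eqVneq (rnorm u) 0; first by rewrite (rnorm_eq0 u0) raddf0.
have {}u0 : 0 < rnorm u by rewrite lt_def u0 rnorm_ge0.
apply/rnorm_le0; rewrite -(@pmulr_lle0 _ (rnorm u)^-1) ?invr_gt0//.
apply: (@expr_small _ r) => // k; rewrite ler_pdivrMr// (PL k).
by apply: le_trans (P_bound _) _; apply: iter_linear_bound.
Qed.

End Coefficients.

(** * Polarization of powers of commuting operators *)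

Section Polarization.
Variables (R : realType) (H : hilbertType R) (A B P : {linear H -> H}) (a b : R).
Hypothesis (A_bound : forall h, rnorm (A h) <= a * rnorm h).
Hypothesis (B_bound : forall h, rnorm (B h) <= b * rnorm h).
Hypothesis P_bound : forall h, rnorm (P h) <= rnorm h.
Hypothesis AB : forall h, A (B h) = B (A h).
Local Notation pert t := (fun x => A x + (t%:C)%C *: B x).

(** Commutation merges the [m + 1] terms linear in [t] into one. The constant [C] is chosen before
    [t], which allows [t] to tend to 0 afterwards. *)
Lemma iter_perturbation h m : exists C : R, forall t : R, 0 < t -> t < 1 ->
  exists2 q, rnorm q <= C &
    iter m.+1 (pert t) h = iter m.+1 A h +
      ((t * m.+1%:R)%:C)%C *: iter m A (B h) + ((t ^+ 2)%:C)%C *: q.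
Proof.
elim: m => [|m [C IH]].
  exists 0 => t _ _; exists 0; first by rewrite rnorm0.
  by rewrite /= mulr1 scaler0 addr0.
(* One more factor [A + t B] turns the remainder [q] into [A q + (m + 1) B A^m B h + t B q]; [D]
   bounds this sum for [t < 1]. *)
pose D := `|a| * C + rnorm ((m.+1%:R%:C)%C *: B (iter m A (B h))) + `|b| * C.
exists D => t t0 t1; have [q qC qE] := IH t t0 t1.
exists (A q + ((m.+1%:R%:C)%C *: B (iter m A (B h)) + (t%:C)%C *: B q)).
  have ab (c : R) : `|c| * rnorm q <= `|c| * C by rewrite ler_wpM2l.
  apply: le_trans (rnormD _ _) _; rewrite /D -addrA lerD//.
    apply: le_trans (A_bound _) _; apply: (le_trans _ (ab a)).
    by rewrite ler_wpM2r ?rnorm_ge0// ler_norm.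
  apply: le_trans (rnormD _ _) _; rewrite lerD2l rnormZ rnorm_real ?(ltW t0)//.
  apply: le_trans (_ : rnorm (B q) <= _); first by rewrite ler_piMl ?rnorm_ge0 ?(ltW t1).
  apply: le_trans (B_bound _) _; apply: (le_trans _ (ab b)).
  by rewrite ler_wpM2r ?rnorm_ge0// ler_norm.
have BA : B (iter m.+1 A h) = A (iter m A (B h)).
  by elim: m {IH D qE} => [|k IHk]; [rewrite /= AB | rewrite [iter k.+2 _ _]iterS -AB IHk].
rewrite iterS qE [iter m.+2 _ _]iterS [iter m.+1 A (B h)]iterS.
have lin (F : {linear H -> H}) x y z c d :
  F (x + c *: y + d *: z) = F x + c *: F y + d *: F z by rewrite !linearD !linearZZ.
rewrite !lin BA -[m.+2%:R]natr1 mulrDr mulr1 !(rmorphD, rmorphM, rmorphXn) /=.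
by lincomb.
Qed.

(* Isolates the part of (A + tB)^(m+1) that is linear in t. *)
Lemma polarization m h :
  (forall t : R, 0 < t -> t < 1 -> P (iter m.+1 (pert t) h) = 0) ->
  P (iter m.+1 A h) = 0 -> P (iter m A (B h)) = 0.
Proof.
move=> P0 PA; have [C expan] := iter_perturbation h m.
suff : rnorm (P (m.+1%:R%:C%C *: iter m A (B h))) = 0.
  by move=> /rnorm_eq0/eqP; rewrite linearZZ scaler_eq0 eq_complex /= pnatr_eq0 => /eqP.
apply: (@small_eq0 _ _ C 1 ltr01 (rnorm_ge0 _)) => t t0 t1.
have [q qC qE] := expan t t0 t1.
(* Applying [P] to the expansion kills both the power of [A + t B] and the power of [A]; what
   remains is divided by [t]. *)
have : P (m.+1%:R%:C%C *: iter m A (B h)) = - ((t%:C)%C *: P q).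
  apply/eqP; rewrite -addr_eq0 -(inj_eq (scalerI (_ : (t%:C)%C != 0))); last first.
    by rewrite eq_complex /= (gt_eqF t0).
  rewrite scaler0 -linearZZ -linearD -linearZZ.
  have := P0 t t0 t1; rewrite qE -addrA linearD PA add0r => P00.
  rewrite -P00; apply/eqP; congr (P _).
  by rewrite !(rmorphM, rmorphXn) /=; lincomb.
move=> ->; rewrite rnormN rnormZ rnorm_real ?(ltW t0)// ler_wpM2l ?(ltW t0)//.
exact: le_trans (P_bound _) qC.
Qed.

End Polarization.

(** * Restrictions to invariant subspaces and orthocomplements *)

Section Restriction.
Variables (R : realType) (H : hilbertType R).

Lemma csub_valP (S : closedSubspace H) (x : csub_type S) : csub_set S (val x).
Proof. by have := valP x; rewrite /csub_pred/= inE. Qed.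

Lemma csub_predP (S : closedSubspace H) x : csub_set S x -> csub_pred S x.
Proof. by move=> Sx; rewrite /csub_pred/= inE. Qed.

Definition csub_mk (S : closedSubspace H) x (Sx : csub_set S x) : csub_type S :=
  exist _ x (csub_predP Sx).

Lemma csub_innerE (S : closedSubspace H) (x y : csub_type S) :
  inner x y = inner (val x) (val y).
Proof. by []. Qed.

Variables (S : closedSubspace H) (A : boundedOp H H).
Hypothesis A_inv : forall x, csub_set S x -> csub_set S (A x).

Definition restr_fun (x : csub_type S) : csub_type S := csub_mk (A_inv (csub_valP x)).

Lemma restr_fun_linear : linear restr_fun.
Proof. by move=> a x y; apply: val_inj; rewrite /= linearP. Qed.

Lemma restr_fun_bound : exists M : R, forall x, rnorm (restr_fun x) <= M * rnorm x.
Proof. by have [M _ AM] := boundedOp_bound A; exists M => x; exact: AM. Qed.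

Definition restr_op : boundedOp (csub_type S) (csub_type S) :=
  bounded_op_of restr_fun_linear (projT2 (cid restr_fun_bound)).

End Restriction.

Section Orthocomplement.
Variables (R : realType) (H : hilbertType R) (B : set H).

Lemma ortho0 : orthocomplement B 0.
Proof. by move=> a _; rewrite inner0l. Qed.

Lemma orthoP (a : R[i]) x y :
  orthocomplement B x -> orthocomplement B y -> orthocomplement B (a *: x + y).
Proof. by move=> Bx By b Bb; rewrite innerDl innerZl Bx// By// mulr0 addr0. Qed.

Lemma ortho_closed : closed (orthocomplement B).
Proof.
move=> x clx a Ba.
apply: (@closed_bounded_ker R H _ (fun y => inner y a) (rnorm a)).
- by move=> y z; rewrite innerBl.
- by move=> y; rewrite mulrC rnorm_inner.
by apply: closure_subset clx => y /(_ a Ba).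
Qed.

Definition ortho_csub := ClosedSubspace ortho0 orthoP ortho_closed.

End Orthocomplement.

(** * Cauchy-Schwarz estimates for finite sums *)

Section RealSums.
Variable R : realType.

(** The squares of [N * b i - a i * c] sum to [N * (N * Y - c ^+ 2)]; if [N = 0], all [a i]
    vanish. *)
Lemma sum_cauchy_schwarz n (a b : 'I_n -> R) :
  (\sum_i a i * b i) ^+ 2 <= (\sum_i a i ^+ 2) * (\sum_i b i ^+ 2).
Proof.
set N := \sum_i a i ^+ 2; set c := \sum_i a i * b i; set Y := \sum_i b i ^+ 2.
have N0 : 0 <= N by apply: sumr_ge0 => i _; exact: sqr_ge0.
have : 0 <= \sum_i (N * b i - a i * c) ^+ 2 by apply: sumr_ge0 => i _; exact: sqr_ge0.
have -> : \sum_i (N * b i - a i * c) ^+ 2 = N * (N * Y - c ^+ 2).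
  transitivity (\sum_i (N ^+ 2 * b i ^+ 2 - 2 * N * c * (a i * b i) + c ^+ 2 * a i ^+ 2)).
    by apply: eq_bigr => i _; ring.
  rewrite big_split sumrB /= -!mulr_sumr -/N -/c -/Y; ring.
have [N00 _|Nn0] := eqVneq N 0; last first.
  by rewrite pmulr_rge0 ?subr_ge0// lt_def Nn0.
have a0 i : a i = 0.
  apply/eqP; rewrite -sqrf_eq0; apply/eqP.
  by apply: (psumr_eq0P (F := fun i => a i ^+ 2) _ N00) => // j _; exact: sqr_ge0.
by rewrite /c big1 ?expr0n/= ?mulr_ge0 ?sumr_ge0// => [i _|i _|i _]; rewrite ?sqr_ge0// a0 mul0r.
Qed.

Lemma rnorm_lincomb (H : hilbertType R) n (a : 'I_n -> R[i]) (y : 'I_n -> H) :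
  rnorm (\sum_i a i *: y i) ^+ 2 <=
  (\sum_i rnorm (a i) ^+ 2) * (\sum_i rnorm (y i) ^+ 2).
Proof.
apply: le_trans (sum_cauchy_schwarz _ _).
rewrite ler_pXn2r ?nnegrE ?rnorm_ge0 ?sumr_ge0// => [|i _]; last by rewrite mulr_ge0 ?rnorm_ge0.
apply: le_trans (rnorm_sum _ _) _.
by rewrite le_eqVlt; apply/orP; left; apply/eqP/eq_bigr => i _; rewrite rnormZ.
Qed.

End RealSums.

(** * The functional model of a regular row partial isometry *)

Section Pencil.
Variables (R : realType) (n : nat) (H : hilbertType R) (S : optuple n H).

Definition pencil (z : 'rV[R[i]]_n) (h : H) : H := \sum_(i < n) z 0 i *: S i h.

Lemma pencil_is_linear z : linear (pencil z).
Proof.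
move=> a g h; rewrite /pencil scaler_sumr -big_split; apply: eq_bigr => i _.
by rewrite linearP scalerDr !scalerA mulrC.
Qed.

HB.instance Definition _ z := GRing.isLinear.Build R[i] H H *:%R (pencil z) (pencil_is_linear z).

Lemma pencilDl z w h : pencil (z + w) h = pencil z h + pencil w h.
Proof. by rewrite -big_split; apply: eq_bigr => i _; rewrite mxE scalerDl. Qed.

Lemma pencilZl a z h : pencil (a *: z) h = a *: pencil z h.
Proof. by rewrite scaler_sumr; apply: eq_bigr => i _; rewrite mxE scalerA. Qed.

Lemma pencil_delta i h : pencil (delta_mx 0 i) h = S i h.
Proof.
rewrite /pencil (bigD1 i)//= big1 => [|j ji]; rewrite mxE ?eqxx/= ?scale1r ?addr0//.
by rewrite (negbTE ji) scale0r.
Qed.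

Lemma pencil_comm z w h : commuting S -> pencil z (pencil w h) = pencil w (pencil z h).
Proof.
move=> S_comm; rewrite /pencil.
transitivity (\sum_i \sum_j (z 0 i * w 0 j) *: S i (S j h)).
  apply: eq_bigr => i _; rewrite (raddf_sum (S i)) scaler_sumr/=.
  by apply: eq_bigr => j _; rewrite boundedOpZ scalerA.
rewrite exchange_big; apply: eq_bigr => j _; rewrite (raddf_sum (S j)) scaler_sumr/=.
by apply: eq_bigr => i _; rewrite boundedOpZ scalerA S_comm mulrC.
Qed.

End Pencil.

Section Model.
Variables (R : realType) (n : nat) (H : hilbertType R) (T T' : optuple n H).
Hypothesis T_comm : commuting T.
Hypothesis adjT : forall i, adjoint_of (T i) (T' i).
Hypothesis T_pi : partial_isometry (@power_inner R n H) (row_op T).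
Local Notation Q := (row_gram T T').
Local Notation A := (pencil T').

(** The squared Euclidean norm as an element of [R], whereas [enorm] lies in [R[i]]. *)
Definition sqn (z : 'rV[R[i]]_n) : R := \sum_(i < n) rnorm (z 0 i) ^+ 2.
Definition sqrn (z : 'rV[R[i]]_n) : R := Num.sqrt (sqn z).

Lemma adj_comm : commuting T'.
Proof.
by move=> i j x; apply: inner_eqP => y; rewrite innerC -!adjT -T_comm !adjT -innerC.
Qed.

Definition wproj (h : H) : H := h - Q h.
Local Notation P := wproj.

Lemma wproj_is_linear : linear P.
Proof.
move=> a g h; rewrite /P row_gramD.
have -> : Q (a *: g) = a *: Q g.
  by rewrite /row_gram /row_op scaler_sumr; apply: eq_bigr => i _; rewrite !boundedOpZ.
by lincomb.
Qed.

HB.instance Definition _ := GRing.isLinear.Build R[i] H H *:%R wproj wproj_is_linear.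

Lemma wproj_sym x y : inner (P x) y = inner x (P y).
Proof. by rewrite innerBl innerBr row_gram_sym. Qed.

Lemma wproj_row h : P (row_op T h) = 0.
Proof. by rewrite /P (partial_isometryP adjT).1// subrr. Qed.

Lemma wproj_T i h : P (T i h) = 0.
Proof.
have := wproj_row (fun j => if j == i then h else 0).
rewrite /row_op (bigD1 i)//= eqxx big1 ?addr0// => j /negbTE ->.
by rewrite raddf0.
Qed.

Lemma adj_wproj i h : T' i (P h) = 0.
Proof. by apply: inner_eqP => x; rewrite innerC -adjT -wproj_sym wproj_T !inner0l conjC0. Qed.

Lemma wproj_idem h : P (P h) = P h.
Proof. by rewrite {1}/P /row_gram /row_op big1 ?subr0// => i _; rewrite adj_wproj raddf0. Qed.

(** Since [P] is a self-adjoint idempotent, [<P h, P h> = <h, h> - <h, Q h>]. The identity yields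
    both that [P] is a contraction and that [A z] has norm at most [sqrn z]. *)
Lemma rnorm_gram h : \sum_i rnorm (T' i h) ^+ 2 + rnorm (P h) ^+ 2 = rnorm h ^+ 2.
Proof.
apply: (@complexI R); rewrite rmorphD rmorph_sum /= -!innerE.
rewrite wproj_sym wproj_idem innerBr.
have -> : inner h (Q h) = \sum_i inner (T' i h) (T' i h) by rewrite -row_gram_sym// row_gram_inner.
under eq_bigr => i _ do rewrite -innerE.
by rewrite addrC subrK.
Qed.

Lemma wproj_bound h : rnorm (P h) <= rnorm h.
Proof.
rewrite -(@ler_pXn2r _ 2) ?nnegrE ?rnorm_ge0// -(rnorm_gram h) lerDr sumr_ge0// => i _.
exact: sqr_ge0.
Qed.

Lemma sqn_ge0 z : 0 <= sqn z.
Proof. by apply: sumr_ge0 => i _; exact: sqr_ge0. Qed.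

Lemma pencil_bound z h : rnorm (A z h) <= sqrn z * rnorm h.
Proof.
rewrite -(@ler_pXn2r _ 2) ?nnegrE ?rnorm_ge0 ?mulr_ge0 ?rnorm_ge0 ?sqrtr_ge0//.
rewrite exprMn sqr_sqrtr ?sqn_ge0//; apply: le_trans (rnorm_lincomb _ _) _.
rewrite ler_wpM2l ?sqn_ge0// -(rnorm_gram h) lerDl exprn_ge0// rnorm_ge0//.
Qed.

Lemma sqrn_lt1 z : (sqrn z < 1) = (sqn z < 1).
Proof. by rewrite -{1}sqrtr1 ltr_sqrt. Qed.

Lemma sqrn_unit_ball z : unit_ball z -> sqrn z < 1.
Proof. by rewrite unit_ballE sqrn_lt1. Qed.

Lemma sqrnZ (t : R) z : 0 <= t -> sqrn ((t%:C)%C *: z) = t * sqrn z.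
Proof.
move=> t0; rewrite /sqrn -{2}(ger0_norm t0) -sqrtr_sqr -sqrtrM ?sqr_ge0//.
congr Num.sqrt; rewrite /sqn mulr_sumr; apply: eq_bigr => i _.
by rewrite mxE rnormM rnorm_real// exprMn.
Qed.

Lemma sqrn_ge0 z : 0 <= sqrn z.
Proof. exact: sqrtr_ge0. Qed.

Lemma unit_ball_sqrn z : sqrn z < 1 -> unit_ball z.
Proof. by rewrite unit_ballE sqrn_lt1. Qed.

(** Regularity enters the model in this form: for small [z] the range of [T - Z] meets W(T) only in
    0, membership in W(T) being written as invariance under [wproj]. *)
Hypothesis direct : exists2 e : R, 0 < e & forall z g, sqrn z < e ->
  wproj (row_op T g - row_scalar z g) = row_op T g - row_scalar z g ->
  row_op T g - row_scalar z g = 0.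

Lemma wproj_small : exists2 e : R, 0 < e & forall z i g u, sqrn z < e ->
  u - A z u = T i g - z 0 i *: g -> P u = 0.
Proof.
have [e e0 dir] := direct; exists e => // z i g u ze uE.
(* With this tuple, [(T - Z) d = (T i g - z_i g) - Q u + A z u = u - Q u = P u], a vector of W(T) in
   the range of [T - Z]. *)
pose d j := (if j == i then g else 0) - T' j u.
have dE : row_op T d - row_scalar z d = P u.
  rewrite row_opB.
  have -> : row_op T (fun j => if j == i then g else 0) = T i g.
    by rewrite /row_op (bigD1 i)//= eqxx big1 ?addr0// => j /negbTE ->; rewrite raddf0.
  have -> : row_scalar z d = z 0 i *: g - A z u.
    rewrite /row_scalar /d; under eq_bigr => j _ do rewrite scalerBr.
    rewrite sumrB; congr (_ - _).
    by rewrite (bigD1 i)//= eqxx big1 ?addr0// => j /negbTE ->; rewrite scaler0.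
  have -> : T i g = u - A z u + z 0 i *: g by rewrite uE subrK.
  rewrite -/(row_gram T T' u) /P; lincomb.
rewrite -dE; apply: dir => //; rewrite dE; exact: wproj_idem.
Qed.

(** [wproj_small] extends from small [z] to the ball along the ray [t z]: small [t] forces the
    Neumann coefficients to vanish, and these determine [P u]. *)
Lemma wproj_mult z i g u : unit_ball z -> u - A z u = T i g - z 0 i *: g -> P u = 0.
Proof.
move=> /sqrn_unit_ball z1 uE.
have [e e0 small] := wproj_small.
(* At [t z] the right side [T i g - t z_i g] depends on [t]. Splitting off [T i g], which [P] kills,
   leaves [t] times the fixed vector [A z (T i g) - z_i g], to which the coefficient lemmas
   apply. *)
have -> : u = T i g + (u - T i g) by rewrite addrC subrK.
rewrite raddfD /= wproj_T add0r.
apply: (@resolvent_of_coefs _ _ (A z) P _ (pencil_bound z) wproj_bound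
  (A z (T i g) - z 0 i *: g)) => //.
- exact: sqrn_ge0.
- by rewrite raddfB /= -[X in X - _ - _](subrK (A z u)) uE; lincomb.
apply: (@coefs_of_resolvent _ _ (A z) P _ (pencil_bound z) wproj_bound (e / (sqrn z + 1))).
- exact: sqrn_ge0.
- by rewrite divr_gt0// ltr_wpDl ?sqrn_ge0.
move=> t v t0 te vE.
have : P (T i g + (t%:C)%C *: v) = 0.
  apply: (small ((t%:C)%C *: z) i g).
    rewrite sqrnZ ?(ltW t0)//; apply: le_lt_trans (_ : t * (sqrn z + 1) < _).
      by rewrite ler_pM2l// lerDl.
    by rewrite -ltr_pdivlMr// ltr_wpDl ?sqrn_ge0.
  rewrite mxE pencilZl.
  have -> : A z (T i g + (t%:C)%C *: v) = A z (T i g) + (t%:C)%C *: A z v.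
    by rewrite linearD linearZZ.
  transitivity (T i g - (t%:C)%C *: (A z (T i g) - (v - (t%:C)%C *: A z v))); first by lincomb.
  by rewrite vE; lincomb.
rewrite raddfD /= wproj_T add0r linearZZ => /eqP.
by rewrite scaler_eq0 eq_complex /= (gt_eqF t0) => /eqP.
Qed.

Lemma iter_pencil_linear z k a x y :
  iter k (A z) (a *: x + y) = a *: iter k (A z) x + iter k (A z) y.
Proof. by elim: k => [//|k IH]; rewrite !iterS IH linearP. Qed.

(** The space H_0. [P A_z^k h] is the homogeneous part of degree [k] of the function
    [P (1 - A_z)^-1 h], so the condition says that this function vanishes; by homogeneity [z] may
    range over the whole space. *)
Definition null_set : set H := [set h | forall z k, P (iter k (A z) h) = 0].

Lemma null_resolvent h z u : null_set h -> sqrn z < 1 -> u - A z u = h -> P u = 0.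
Proof.
move=> h0 z1 uE.
exact: (@resolvent_of_coefs _ _ (A z) P _ (pencil_bound z) wproj_bound h u
  (sqrn_ge0 z) z1 uE (h0 z)).
Qed.

Lemma null_of_resolvent h : (forall z u, sqrn z < 1 -> u - A z u = h -> P u = 0) -> null_set h.
Proof.
move=> kill z; have z1 : 0 < sqrn z + 1 by rewrite ltr_wpDl ?sqrn_ge0.
apply: (@coefs_of_resolvent _ _ (A z) P _ (pencil_bound z) wproj_bound (sqrn z + 1)^-1) => //.
- exact: sqrn_ge0.
- by rewrite invr_gt0.
move=> t u t0 tz uE; apply: (kill ((t%:C)%C *: z)); last by rewrite pencilZl.
rewrite sqrnZ ?(ltW t0)//; apply: le_lt_trans (_ : t * (sqrn z + 1) < _).
  by rewrite ler_pM2l// lerDl.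
by rewrite -ltr_pdivlMr// div1r.
Qed.

Lemma null_set0 : null_set 0.
Proof.
move=> z k; have -> : iter k (A z) 0 = 0 by elim: k => [//|k /= ->]; rewrite raddf0.
by rewrite raddf0.
Qed.

Lemma null_setP (a : R[i]) x y : null_set x -> null_set y -> null_set (a *: x + y).
Proof. by move=> x0 y0 z k; rewrite iter_pencil_linear linearP /= x0 y0 scaler0 addr0. Qed.

Lemma null_set_closed : closed null_set.
Proof.
move=> x clx z k.
have : closed [set y | P (iter k (A z) y) = 0].
  apply: (@closed_bounded_ker R H H _ (sqrn z ^+ k)) => [y y'|y].
    by rewrite -raddfB /= addrC -scaleN1r iter_pencil_linear scaleN1r addrC.
  apply: le_trans (wproj_bound _) _.
  exact: (iter_linear_bound (pencil_bound z) _ _ (sqrn_ge0 z)).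
by apply; apply: closure_subset clx => y; apply.
Qed.

Definition null_csub := ClosedSubspace null_set0 null_setP null_set_closed.

Lemma pencil_solve z f : sqrn z < 1 -> exists u, u - A z u = f.
Proof. by move=> z1; exact: (resolvent_solve (pencil_bound z) f (sqrn_ge0 z) z1). Qed.

(** By [wproj_mult], the function attached to [T i h] is [z_i] times the one attached to [h]. *)
Lemma null_T i h : null_set h -> null_set (T i h).
Proof.
move=> h0; apply: null_of_resolvent => z u z1 uE.
have [v vE] := pencil_solve h z1.
have : P (u - z 0 i *: v) = 0.
  apply: (@wproj_mult z i h); first exact: unit_ball_sqrn.
  have -> : A z (u - z 0 i *: v) = A z u - z 0 i *: A z v by rewrite linearB linearZZ.
  by rewrite -uE -[in RHS]vE; lincomb.
by rewrite linearB linearZZ /= (null_resolvent h0 z1 vE) scaler0 subr0.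
Qed.

(** Replacing [z] by [z + t e_i] in the vanishing coefficient of degree [k + 1], the part linear in
    [t] is a multiple of [P A_z^k T'_i h]. *)
Lemma null_adj i h : null_set h -> null_set (T' i h).
Proof.
move=> h0 z k.
have := @polarization R H (A z) (A (delta_mx 0 i)) P _ _ (pencil_bound z)
  (pencil_bound _) wproj_bound (fun x => pencil_comm _ _ x adj_comm) k h.
rewrite -pencil_delta => pol; apply: pol; last exact: h0.
move=> t t0 t1; rewrite -[RHS](h0 (z + (t%:C)%C *: delta_mx 0 i) k.+1); congr (P _).
by apply: eq_iter => x; rewrite pencilDl pencilZl.
Qed.

Definition shift_csub := ortho_csub null_set.

Lemma shift_T i x : csub_set shift_csub x -> csub_set shift_csub (T i x).
Proof. by move=> xo a a0; rewrite adjT; apply: xo; exact: null_adj. Qed.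

Definition coisometry_part : optuple n (csub_type null_csub) :=
  fun i => restr_op (@null_T i : forall x, csub_set null_csub x -> _).
Definition shift_part : optuple n (csub_type shift_csub) :=
  fun i => restr_op (@shift_T i).

Lemma coisometry_part_spherical : spherical_coisometry coisometry_part.
Proof.
split; first by move=> i j x; apply: val_inj; exact: T_comm.
exists (fun i => restr_op (@null_adj i : forall x, csub_set null_csub x -> _)).
  by move=> i x y; exact: adjT.
move=> x; apply: val_inj; rewrite raddf_sum /=.
(* The coefficient of degree 0 is [P x]; its vanishing means [Q x = x]. *)
have := csub_valP x 0 0%N; rewrite /= /P => /eqP; rewrite subr_eq0 => /eqP {2}->.
by [].
Qed.

Lemma shift_part_commuting : commuting shift_part.
Proof. by move=> i j x; apply: val_inj; exact: T_comm. Qed.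

Lemma model_direct_sum : is_direct_sum T coisometry_part shift_part.
Proof.
pose J (p : csub_type null_csub * csub_type shift_csub) : H := val p.1 + val p.2.
have J_lin : linear J.
  move=> a p q.
  transitivity ((a *: val p.1 + val q.1) + (a *: val p.2 + val q.2)); first by [].
  by rewrite /J; lincomb.
exists (linear_fun_of J_lin); split.
- move=> p q; rewrite /linear_fun_of /J innerDl !innerDr !csub_innerE.
  have o : inner (val p.2) (val q.1) = 0 by apply: (csub_valP p.2); exact: (csub_valP q.1).
  have o' : inner (val p.1) (val q.2) = 0.
    by rewrite innerC (csub_valP q.2 _ (csub_valP p.1)) conjC0.
  by rewrite o o' addr0 add0r.
- move=> x; have [p p0 po] := orth_proj null_csub x.
  exists (csub_mk p0, csub_mk (po : csub_set shift_csub (x - p))).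
  by change (p + (x - p) = x); rewrite addrC subrK.
- by move=> i p; exact: raddfD.
Qed.

(** * The wandering subspace and the evaluation map *)

Definition wander_csub := ortho_csub (range (row_op T)).

Lemma wproj_wander h : csub_set wander_csub (P h).
Proof. by move=> _ [g _ <-]; rewrite wproj_sym wproj_row inner0r. Qed.

Lemma adj_wander x i : csub_set wander_csub x -> T' i x = 0.
Proof.
move=> xw; apply: inner_eqP => y; rewrite innerC -adjT innerC conjCK inner0l.
apply: xw; exists (fun j => if j == i then y else 0) => //.
by rewrite /row_op (bigD1 i)//= eqxx big1 ?addr0// => j /negbTE ->; rewrite raddf0.
Qed.

Lemma wproj_wanderK x : csub_set wander_csub x -> P x = x.
Proof.
move=> xw; rewrite /P /row_gram /row_op big1 ?subr0// => i _.
by rewrite adj_wander// raddf0.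
Qed.

Definition wproj_csub (h : H) : csub_type wander_csub := csub_mk (wproj_wander h).

Lemma wproj_csub_is_linear : linear wproj_csub.
Proof. by move=> a g h; apply: val_inj; rewrite /= linearP. Qed.

HB.instance Definition _ :=
  GRing.isLinear.Build R[i] H (csub_type wander_csub) *:%R wproj_csub wproj_csub_is_linear.

(** The default value 0 is taken where the equation has no solution; in the ball there is exactly
    one. *)
Definition resolvent (z : 'rV[R[i]]_n) (f : H) : H := xget 0 [set u | u - A z u = f].

Lemma resolventP z f : (exists u, u - A z u = f) -> resolvent z f - A z (resolvent z f) = f.
Proof. by move=> solv; exact: (@xgetPex _ 0 [set u | u - A z u = f] solv). Qed.

Lemma resolvent_opE z f u : sqrn z < 1 -> u - A z u = f -> resolvent z f = u.
Proof.
move=> z1 uE; apply: (resolvent_uniq (pencil_bound z) z1).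
by rewrite uE resolventP//; exists u.
Qed.

Lemma resolvent_is_linear z : sqrn z < 1 -> linear (resolvent z).
Proof.
move=> z1 a f g; apply: resolvent_opE => //; rewrite linearP.
move: (resolvent z f) (resolvent z g)
  (resolventP (pencil_solve f z1)) (resolventP (pencil_solve g z1)).
by move=> u v <- <-; lincomb.
Qed.

Definition model_ev (f : csub_type shift_csub) (z : 'rV[R[i]]_n) : csub_type wander_csub :=
  wproj_csub (resolvent z (val f)).

Lemma model_mult : is_mult_tuple model_ev shift_part.
Proof.
move=> i f z zb; have z1 := sqrn_unit_ball zb.
apply/eqP; rewrite -subr_eq0 -linearZZ -linearB; apply/eqP/val_inj => /=.
apply: (@wproj_mult z i (val f)) => //.
move: (resolvent z (T i (val f))) (resolvent z (val f))
  (resolventP (pencil_solve (T i (val f)) z1))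
  (resolventP (pencil_solve (val f) z1)).
move=> u v <- <-.
have -> : A z (u - z 0 i *: v) = A z u - z 0 i *: A z v by rewrite linearB linearZZ.
by lincomb.
Qed.

(** This is the adjoint of [B (1 - A_w) = 1], the adjoint of [A_w] being the combination of the
    [T i] with conjugated coefficients. *)
Lemma kernel_equation w (B Bs : boundedOp H H) x :
  (forall f, B (f - A w f) = f) -> adjoint_of B Bs ->
  Bs x = x + \sum_(i < n) (w 0 i)^* *: T i (Bs x).
Proof.
move=> BL adjB; apply: inner_eqP => f; rewrite innerC [RHS]innerC; congr (_^*).
rewrite innerDr -{2}(BL f) adjB innerBl.
suff -> : inner f (\sum_(i < n) (w 0 i)^* *: T i (Bs x)) = inner (A w f) (Bs x).
  by rewrite subrK.
rewrite inner_sumr inner_suml; apply: eq_bigr => i _.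
by rewrite innerZr conjCK innerZl (adjoint_sym (adjT i)).
Qed.

(** Applying [P (1 - A_z)^-1] to the equation for [k] gives [v = x + <z, w> v] for the value [v]:
    the resolvent fixes [x], since every [T' i] kills W(T), and [T i] becomes multiplication by
    [z_i]. *)
Lemma kernel_value z w k x : unit_ball z -> unit_ball w ->
  csub_set wander_csub x -> k = x + \sum_(i < n) (w 0 i)^* *: T i k ->
  P (resolvent z k) = (1 - cdot z w)^-1 *: x.
Proof.
move=> zb wb xw kE; have z1 := sqrn_unit_ball zb.
pose Rz : {linear H -> H} := linear_fun_of (resolvent_is_linear z1).
have Rx : Rz x = x.
  by apply: resolvent_opE => //; rewrite /pencil big1 ?subr0// => i _; rewrite adj_wander// scaler0.
have RT i : P (Rz (T i k)) = z 0 i *: P (Rz k).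
  apply/eqP; rewrite -subr_eq0 -linearZZ -raddfB; apply/eqP.
  apply: (@wproj_mult z i k) => //.
  have /= := resolventP (pencil_solve (T i k) z1); have /= := resolventP (pencil_solve k z1).
  rewrite /Rz /linear_fun_of; move: (resolvent z (T i k)) (resolvent z k) => u v vE uE.
  have -> : A z (u - z 0 i *: v) = A z u - z 0 i *: A z v by rewrite linearB linearZZ.
  by rewrite -uE -[in RHS]vE; lincomb.
have PE : P (Rz k) = x + cdot z w *: P (Rz k).
  rewrite {1}kE raddfD raddf_sum raddfD raddf_sum /= Rx wproj_wanderK//; congr (_ + _).
  rewrite scaler_suml; apply: eq_bigr => i _.
  have -> : Rz ((w 0 i)^* *: T i k) = (w 0 i)^* *: Rz (T i k) by exact: linearZZ.
  have -> : P ((w 0 i)^* *: Rz (T i k)) = (w 0 i)^* *: P (Rz (T i k)) by exact: linearZZ.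
  by rewrite RT scalerA mulrC.
have c1 := cdot_neq1 zb wb.
apply: (scalerI c1); rewrite scalerA mulfV// scale1r scalerBl scale1r.
by change (P (Rz k) - cdot z w *: P (Rz k) = x); rewrite {1}PE addrK.
Qed.

Lemma model_rkhs : is_rkhs (@unit_ball R n) model_ev (fun z w x => (1 - cdot z w)^-1 *: x).
Proof.
split.
- move=> a f g z zb; have z1 := sqrn_unit_ball zb.
  rewrite /model_ev -linearP; congr wproj_csub.
  exact: (resolvent_is_linear z1).
(* The difference lies in the orthocomplement of [null_set] and, its function being zero, also in
   [null_set]. *)
- move=> f g fg; apply: val_inj; apply/eqP; rewrite -subr_eq0; apply/eqP/inner_eq0.
  have fgS : csub_set shift_csub (val f - val g) := csub_valP (f - g).
  apply: fgS; apply: null_of_resolvent => z u z1 uE.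
  have /(congr1 val)/= := fg z (unit_ball_sqrn z1).
  have <- : resolvent z (val f) - resolvent z (val g) = u.
    apply/esym; rewrite -(resolvent_opE z1 uE).
    by have /= := raddfB (linear_fun_of (resolvent_is_linear z1)) (val f) (val g).
  by move=> e; rewrite raddfB /= e subrr.
- move=> w x wb; have w1 := sqrn_unit_ball wb.
  have [B [BR BL]] := resolvent_exists (pencil_bound w) (sqrn_ge0 w) w1.
  have [Bs adjB] := adjoint_exists B.
  have xw := csub_valP x.
  have kP f : inner f (Bs (val x)) = inner (P (B f)) (val x).
    by rewrite -adjB wproj_sym wproj_wanderK.
  (* For [a] in [null_set], [<a, Bs x> = <P (B a), x> = 0], so the kernel vector belongs to the
     model space. *)
  have kS : csub_set shift_csub (Bs (val x)).
    by move=> a a0; rewrite innerC kP (null_resolvent a0 w1 (BR a)) inner0l conjC0.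
  exists (csub_mk kS).
    move=> z zb; apply: val_inj; apply: (kernel_value zb wb xw).
    exact: kernel_equation BL adjB.
  move=> f; rewrite !csub_innerE /= kP; congr (inner (P _) _).
  by apply/esym/resolvent_opE.
Qed.

(** * Analyticity of the model functions *)

Lemma coord_rnorm (z : 'rV[R[i]]_n) i : rnorm (z 0 i) <= rnorm z.
Proof.
rewrite -lecR -!rnormE; change (`|z 0 i| <= mx_norm z).
rewrite mx_normE -[leLHS]nngE num_le.
exact: (le_bigmax _ (fun j => `|z j.1 j.2|%:nng) (0, i)).
Qed.

(** Differentiability refers to the maximum norm on row vectors, the operator bounds to the
    Euclidean one. The crude factor [n + 1] avoids a square root and is always positive. *)
Lemma sqrn_rnorm (z : 'rV[R[i]]_n) : sqrn z <= (n%:R + 1) * rnorm z.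
Proof.
have n1 : 0 <= n%:R + 1 :> R by rewrite addr_ge0.
rewrite -(@ler_pXn2r _ 2) ?nnegrE ?sqrn_ge0 ?mulr_ge0 ?rnorm_ge0//.
rewrite sqr_sqrtr ?sqn_ge0// exprMn.
apply: (@le_trans _ _ (n%:R * rnorm z ^+ 2)).
  have -> : n%:R * rnorm z ^+ 2 = \sum_(i < n) rnorm z ^+ 2.
    by rewrite sumr_const card_ord mulr_natl.
  apply: ler_sum => i _.
  by rewrite ler_pXn2r ?nnegrE ?rnorm_ge0// coord_rnorm.
rewrite ler_wpM2r ?exprn_ge0 ?rnorm_ge0//.
have : 0 <= n%:R :> R by []. nra.
Qed.

Lemma model_differentiable f z : unit_ball z -> cdifferentiable (model_ev f) z.
Proof.
move=> zb; have z1 := sqrn_unit_ball zb; have z0 := sqrn_ge0 z.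
pose u := resolvent z (val f).
have uE : u - A z u = val f by apply: resolventP; exact: pencil_solve.
(* The remainder is (1 - A_(h+z))^-1 A_h (1 - A_z)^-1 A_h u, quadratic in h. *)
pose D (h : 'rV[R[i]]_n) : csub_type wander_csub := wproj_csub (resolvent z (A h u)).
have D_lin : linear D.
  move=> a h h'; rewrite /D -linearP; congr wproj_csub.
  by rewrite pencilDl pencilZl; exact: (resolvent_is_linear z1).
pose N : R := n%:R + 1; have N0 : 0 < N by rewrite ltr_wpDl.
have Ah h y : rnorm (A h y) <= N * rnorm h * rnorm y.
  by apply: le_trans (pencil_bound _ _) _; rewrite ler_wpM2r ?rnorm_ge0// sqrn_rnorm.
have s0 : 0 < 1 - sqrn z by rewrite subr_gt0.
have vE h : resolvent z (A h u) - A z (resolvent z (A h u)) = A h u.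
  by apply: resolventP; exact: pencil_solve.
have vb h : rnorm (resolvent z (A h u)) <= N * rnorm h * rnorm u / (1 - sqrn z).
  apply: le_trans (resolvent_bound (pencil_bound z) z1 (vE h)) _.
  by rewrite ler_wpM2r ?invr_ge0 ?(ltW s0).
have D_bound h : rnorm (D h) <= N * rnorm u / (1 - sqrn z) * rnorm h.
  apply: le_trans (wproj_bound _) _; apply: le_trans (vb h) _.
  by rewrite le_eqVlt; apply/orP; left; apply/eqP; ring.
(* For [|h| < d] the norm of [A h] is at most [(1 - sqrn z) / 2], so that of [A (h + z)] is at most
   [r], the midpoint of [sqrn z] and 1. *)
pose d := (1 - sqrn z) / (2 * N).
pose r := (1 + sqrn z) / 2.
have r1 : r < 1 by rewrite /r; lra.
have r1' : 0 < 1 - r by rewrite subr_gt0.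
(* Each of the two factors [A h] contributes [N * rnorm h], and the two resolvents contribute the
   denominators; the added 1 makes [C] strictly positive. *)
pose C := N ^+ 2 * rnorm u / ((1 - sqrn z) * (1 - r)) + 1.
have C0 : 0 < C.
  rewrite /C ltr_wpDl// divr_ge0 ?mulr_ge0 ?rnorm_ge0 ?exprn_ge0 ?(ltW N0) ?(ltW s0)//.
  by rewrite ltW.
apply: (@differentiable_remainder _ _ _ _ (linear_fun_of D_lin) _ (C%:C)%C (d%:C)%C).
- exact: (linear_fun_of_continuous D_bound).
- by rewrite ltcR divr_gt0// mulr_gt0.
- by rewrite ltcR.
move=> h; rewrite rnormE ltcR => hd.
rewrite !rnormE -rmorphXn -rmorphM lecR.
have hb y : rnorm (A (h + z) y) <= r * rnorm y.
  rewrite pencilDl; apply: le_trans (rnormD _ _) _.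
  have hN : N * rnorm h <= (1 - sqrn z) / 2.
    rewrite mulrC -ler_pdivlMr// ltW//; move: hd; rewrite /d invfM mulrA; exact.
  have -> : r = (1 - sqrn z) / 2 + sqrn z by rewrite /r; field.
  rewrite mulrDl lerD ?pencil_bound//; apply: le_trans (Ah _ _) _.
  by rewrite ler_wpM2r ?rnorm_ge0.
have r0 : 0 <= r by rewrite /r; lra.
pose u' := resolvent (h + z) (val f).
have uE' : u' - A (h + z) u' = val f.
  by apply: resolventP; exact: (resolvent_solve hb _ r0 r1).
pose v := resolvent z (A h u).
have remE : (u' - u - v) - A (h + z) (u' - u - v) = A h v.
  have -> : A (h + z) (u' - u - v) = A (h + z) u' - A (h + z) u - A (h + z) v.
    by rewrite !linearB.
  rewrite !pencilDl.
  have : v - A z v = A h u by exact: vE.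
  move: uE'; rewrite pencilDl -uE => /eqP; rewrite subr_eq => /eqP {1}->.
  by move=> <-; lincomb.
have -> : model_ev f (h + z) - model_ev f z - linear_fun_of D_lin h = wproj_csub (u' - u - v).
  by rewrite !raddfB.
apply: le_trans (wproj_bound _) _.
apply: le_trans (resolvent_bound hb r1 remE) _.
rewrite ler_pdivrMr//; apply: le_trans (Ah _ _) _.
apply: le_trans (ler_wpM2l _ (vb h)) _; first by rewrite mulr_ge0 ?rnorm_ge0 ?ltW.
rewrite /C; set X := _ / ((1 - sqrn z) * (1 - r)).
have -> : N * rnorm h * (N * rnorm h * rnorm u / (1 - sqrn z)) = X * rnorm h ^+ 2 * (1 - r).
  by rewrite /X; field; rewrite !gt_eqF.
have -> : (X + 1) * rnorm h ^+ 2 * (1 - r) =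
    X * rnorm h ^+ 2 * (1 - r) + rnorm h ^+ 2 * (1 - r) by ring.
by rewrite lerDl mulr_ge0 ?exprn_ge0 ?rnorm_ge0 ?(ltW r1').
Qed.

End Model.

(** A vector fixed by [wproj] lies in W(T), so the trivial intersection in the algebraic direct sum
    makes it 0 as soon as it is in the range of [T - Z]. *)
Lemma regular_direct (R : realType) (n : nat) (H : hilbertType R)
    (T T' : optuple n H) :
  (forall i, adjoint_of (T i) (T' i)) ->
  partial_isometry (@power_inner R n H) (row_op T) -> regular_at0 T ->
  exists2 e : R, 0 < e & forall z g, sqrn z < e ->
    wproj T T' (row_op T g - row_scalar z g) = row_op T g - row_scalar z g ->
    row_op T g - row_scalar z g = 0.
Proof.
move=> adjT T_pi [_ [_ /pos_complexE[e e0 ->] reg]].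
exists e => // z g ze wE.
have [|_ [_ trivial]] := reg z.
  rewrite enorm_ltP// -[ltLHS](sqr_sqrtr (sqn_ge0 z)).
  by rewrite ltr_pXn2r ?nnegrE ?sqrn_ge0 ?(ltW e0).
apply: trivial; split; first by exists g.
by rewrite -wE; exact: (wproj_wander adjT T_pi).
Qed.

Theorem corollary11 (R : realType) (n : nat) (n_ge1 : (1 <= n)%N)
    (H : hilbertType R) (T : optuple n H)
    (T_commuting : commuting T) (T_regular : regular_at0 T) :
  partial_isometry (@power_inner R n H) (row_op T) <->
  exists (H0 H1 : hilbertType R) (T0 : optuple n H0) (T1 : optuple n H1),
    [/\ is_direct_sum T T0 T1,
        spherical_coisometry T0,
        commuting T1
      & exists (D F : hilbertType R) (ev : F -> 'rV[R[i]]_n -> D)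
          (M_z : optuple n F),
          [/\ is_drury_arveson ev, is_mult_tuple ev M_z
            & unitarily_equivalent T1 M_z]].
Proof.
split=> [T_pi|[H0 [H1 [T0 [T1 [T_sum T0_cois _ [D [F [ev [M_z [DA mult equiv]]]]]]]]]]].
  have [T' adjT] := adjoint_tuple_exists T.
  have direct := regular_direct adjT T_pi T_regular.
  exists (csub_type (null_csub adjT T_pi)), (csub_type (shift_csub T T')).
  exists (coisometry_part adjT T_pi direct).
  exists (shift_part T_commuting adjT T_pi).
  split.
  - exact: model_direct_sum.
  - exact: coisometry_part_spherical.
  - exact: shift_part_commuting.
  (* The coefficient space is W(T), and the orthocomplement of H_0 serves as the function space
     itself, so the intertwining unitary is the identity. *)
  exists (csub_type (wander_csub T)), (csub_type (shift_csub T T')).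
  exists (model_ev adjT T_pi), (shift_part T_commuting adjT T_pi).
  split.
  - split; first exact: model_rkhs.
    by move=> f z; exact: model_differentiable.
  - exact: model_mult.
  by exists idfun => //; split=> // y; exists y.
apply: (direct_sum_partial_isometry T_sum).
  exact: spherical_partial_isometry.
apply: (unitary_partial_isometry equiv).
exact: (drury_arveson_partial_isometry DA mult).
Qed.
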